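(* Let $\mathcal{S}=\{\sigma_0,\dots,\sigma_{N-1}\}$, $N\ge 2$, be an iterated function system (possibly with essential overlap) on a complete and separable metric space $(Y,d)$, with attractor set $X$ and Hutchinson measure $\mu$. Let $A$ be the unique positive operator-valued measure with respect to $(X,L^2(X,\mu))$ satisfying $A(\cdot)=\sum_{i=0}^{N-1}S_iA(\sigma_i^{-1}(\cdot))S_i^*$, where $S_i=F_i^*$ and $F_i\phi=\frac1{\sqrt N}(\phi\circ\sigma_i)$ on $L^2(X,\mu)$. Let $\Omega=\prod_1^\infty\{0,\dots,N-1\}$ with Bernoulli measure $P$, let $E$ be the unique projection-valued measure with respect to $(\Omega,L^2(\Omega,P))$ satisfying $E(\cdot)=\sum_{i=0}^{N-1}T_iE(\eta_i^{-1}(\cdot))T_i^*$, let $\pi:\Omega\to X$ be the coding map, and let $V:L^2(X,\mu)\to L^2(\Omega,P)$ be the isometry $V(f)=f\circ\pi$. Then the projection-valued measure $E(\pi^{-1}(\cdot))$ and the positive operator-valued measure $A$ are related by $$V^*E(\pi^{-1}(\cdot))V=A(\cdot).$$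
   Context: A Lipschitz contraction on a metric space $(Z,d_Z)$ is a map $L:Z\to Z$ for which there is $r$ with $0<r<1$ and $d_Z(L(x),L(y))\le r\,d_Z(x,y)$ for all $x,y\in Z$. An iterated function system (IFS) on a complete separable metric space $Y$ is a finite family $\{\sigma_0,\dots,\sigma_{N-1}\}$, $N\ge 2$, of Lipschitz contractions on $Y$. Its attractor set is the unique nonempty compact $X\subseteq Y$ with $X=\bigcup_{i=0}^{N-1}\sigma_i(X)$; each $\sigma_i$ restricts to a map $X\to X$. Its Hutchinson measure is the unique Borel probability measure $\mu$ on $Y$ that integrates all real-valued Lipschitz functions on $Y$ and satisfies $\mu(\cdot)=\frac1N\sum_{i=0}^{N-1}\mu(\sigma_i^{-1}(\cdot))$; its support is $X$. Essential overlap means $\mu(\sigma_i(X)\cap\sigma_j(X))>0$ for some $i\ne j$; no assumption on overlap is made. A positive operator-valued measure (POVM) with respect to $(X,\mathcal{H})$, where $X$ is a compact metric space with Borel sets $\mathscr{B}(X)$ and $\mathcal{H}$ a Hilbert space, is a map $A:\mathscr{B}(X)\to\mathcal{B}(\mathcal{H})$ such that: $A(\Delta)$ is positive ($\langle A(\Delta)h,h\rangle\ge0$ for all $h\in\mathcal{H}$) for all $\Delta$; $A(\emptyset)=0$, $A(X)=\mathrm{id}_{\mathcal{H}}$; and for pairwise disjoint $\{\Delta_n\}_{n=1}^\infty\subseteq\mathscr{B}(X)$ and $g,h\in\mathcal{H}$, $\langle A(\bigcup_n\Delta_n)g,h\rangle=\sum_n\langle A(\Delta_n)g,h\rangle$.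 A projection-valued measure is a POVM $F$ whose values are projections ($F(\Delta)^*=F(\Delta)=F(\Delta)^2$) and which satisfies $F(\Delta_1\cap\Delta_2)=F(\Delta_1)F(\Delta_2)$ for all $\Delta_1,\Delta_2$. The fixed POVM $A$ with respect to $(X,L^2(X,\mu))$ exists and is unique. $\Omega$ is a compact metric space with metric $m(\alpha,\beta)=2^{-j}$, where $j\in\mathbb{N}$ is the first entry at which $\alpha\neq\beta$ differ (and $m(\alpha,\alpha)=0$). For $0\le i\le N-1$, $\eta_i:\Omega\to\Omega$ is $\eta_i(\alpha_1,\alpha_2,\dots)=(i,\alpha_1,\alpha_2,\dots)$, and $\eta(\alpha_1,\alpha_2,\alpha_3,\dots)=(\alpha_2,\alpha_3,\dots)$. The family $\{\eta_0,\dots,\eta_{N-1}\}$ is an IFS on $\Omega$ with attractor $\Omega$; the Bernoulli measure $P$ is its Hutchinson measure, the Borel probability measure with $P(\cdot)=\frac1N\sum_{i=0}^{N-1}P(\eta_i^{-1}(\cdot))$. The operators $T_i:L^2(\Omega,P)\to L^2(\Omega,P)$ are $T_i\phi=\sqrt N(\phi\circ\eta)\mathbf{1}_{\eta_i(\Omega)}$, with adjoints $T_i^*\phi=\frac1{\sqrt N}(\phi\circ\eta_i)$; they satisfy the Cuntz relations $\sum_{i=0}^{N-1}T_iT_i^*=\mathrm{id}$ and $T_i^*T_j=\delta_{i,j}\,\mathrm{id}$, and the projection-valued measure $E$ exists and is unique. The coding map $\pi:\Omega\to X$ sends $\alpha=(\alpha_1,\alpha_2,\dots)$ to the single point of $\bigcap_{n=1}^\infty\sigma_{\alpha_1}\circ\cdots\circ\sigma_{\alpha_n}(X)$;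 it is continuous. *)

(* Defs.v *)
From HB Require Import structures.
From mathcomp Require Import all_boot all_order all_algebra.
From mathcomp Require Import all_classical all_reals all_analysis.
From mathcomp Require Import measurable_realfun.
From mathcomp Require Import sesquilinear ring_quotient generic_quotient.
From mathcomp Require Import complex.

Set Implicit Arguments.
Unset Strict Implicit.
Unset Printing Implicit Defensive.

Import Order.TTheory GRing.Theory Num.Theory.
Import numFieldNormedType.Exports.

Local Open Scope classical_set_scope.
Local Open Scope ring_scope.
Local Open Scope complex_scope.
Local Open Scope quotient_scope.

#[short(type="pmetricType")]
HB.structure Definition PointedMetric (R : numDomainType) :=
  {T of Pointed T & Metric R T}.

#[short(type="completeMetricType")]
HB.structure Definition CompleteMetric (R : numDomainType) :=
  {T of Complete T & Metric R T}.

Notation borel T := (g_sigma_algebraType (@open T)).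

Definition separable_space (T : topologicalType) :=
  exists2 D : set T, countable D & dense D.

Lemma complex_ReD (R : realType) (x y : R[i]) :
  complex.Re (x + y) = complex.Re x + complex.Re y.
Proof. by case: x y => [? ?] [? ?]. Qed.

Lemma complex_ImD (R : realType) (x y : R[i]) :
  complex.Im (x + y) = complex.Im x + complex.Im y.
Proof. by case: x y => [? ?] [? ?]. Qed.

Lemma complex_ReM (R : realType) (x y : R[i]) :
  complex.Re (x * y) = complex.Re x * complex.Re y - complex.Im x * complex.Im y.
Proof. by case: x y => [? ?] [? ?]. Qed.

Lemma complex_ImM (R : realType) (x y : R[i]) :
  complex.Im (x * y) = complex.Re x * complex.Im y + complex.Im x * complex.Re y.
Proof. by case: x y => [? ?] [? ?]. Qed.

Section L2_space.
Context d (T : measurableType d) (R : realType).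
Variable mu : {measure set T -> \bar R}.

Definition sqint : {pred T -> R[i]} :=
  [pred f : T -> R[i] | ((fun x => complex.Re (f x)) \in Lfun mu 2%:E) &&
            ((fun x => complex.Im (f x)) \in Lfun mu 2%:E)].

Let LfunD (f g : T -> R) : f \in Lfun mu 2%:E -> g \in Lfun mu 2%:E ->
  (fun x => f x + g x) \in Lfun mu 2%:E.
Proof.
move=> hf hg.
have -> : (fun x => f x + g x) = f + g by [].
have := Lfun_addr_closed mu (lee1n 2 : (1%:E <= 2%:E :> \bar R)%E).
by case=> _ /(_ _ _ hf hg).
Qed.

Let LfunZ a (f : T -> R) : f \in Lfun mu 2%:E ->
  (fun x => a * f x) \in Lfun mu 2%:E.
Proof.
move=> hf.
have -> : (fun x => a * f x) = a \o* f by apply/funext => x /=; rewrite mulrC.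
by apply: Lfun_scale => //; rewrite ler1n.
Qed.

Lemma sqint_submod_closed : submod_closed sqint.
Proof.
split.
  rewrite inE/=; apply/andP; split;
    exact: (Lfun_addr_closed mu (lee1n 2 : (1%:E <= 2%:E :> \bar R)%E)).1.
move=> a f g; rewrite !inE => /andP[fr fi] /andP[gr gi]; apply/andP; split.
  have -> : (fun x => complex.Re ((a *: f + g) x)) =
     (fun x => (complex.Re a * complex.Re (f x) + (- complex.Im a) * complex.Im (f x)) + complex.Re (g x)).
    apply/funext => x; rewrite /= /GRing.scale /=.
    by rewrite complex_ReD complex_ReM mulNr.
  by do !apply: LfunD => //; exact: LfunZ.
have -> : (fun x => complex.Im ((a *: f + g) x)) =
     (fun x => (complex.Re a * complex.Im (f x) + complex.Im a * complex.Re (f x)) + complex.Im (g x)).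
  apply/funext => x; rewrite /= /GRing.scale /=.
  by rewrite complex_ImD complex_ImM.
by do !apply: LfunD => //; exact: LfunZ.
Qed.

HB.instance Definition _ :=
  GRing.isSubmodClosed.Build _ _ sqint sqint_submod_closed.

Record L2fun := MkL2fun { L2fun_val : T -> R[i] ; _ : L2fun_val \in sqint }.
HB.instance Definition _ := [isSub for L2fun_val].
HB.instance Definition _ := [Choice of L2fun by <:].
HB.instance Definition _ := [SubChoice_isSubLmodule of L2fun by <:].

Definition L2null : {pred L2fun} :=
  [pred f | `[< {ae mu, forall x, L2fun_val f x = 0} >]].

Lemma L2null_submod_closed : submod_closed L2null.
Proof.
split; first by rewrite unfold_in; apply/asboolP; apply: filterE => x.
move=> a f g; rewrite !unfold_in => /asboolP f0 /asboolP g0; apply/asboolP.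
apply: filterS2 f0 g0 => x fx gx /=.
by rewrite !fctE fx gx scaler0 addr0.
Qed.

HB.instance Definition _ :=
  GRing.isSubmodClosed.Build _ _ L2null L2null_submod_closed.

Definition L2 : Type := Quotient.quot L2null.
HB.instance Definition _ := GRing.Zmodule.on L2.
HB.instance Definition _ := EqQuotient.on L2.


Lemma L2funB f g x : L2fun_val (f - g) x = L2fun_val f x - L2fun_val g x.
Proof. by []. Qed.

Lemma L2funZ a f x : L2fun_val (a *: f) x = a * L2fun_val f x.
Proof. by []. Qed.

Lemma L2P (f g : L2fun) :
  \pi_L2 f = \pi_L2 g <-> {ae mu, forall x, L2fun_val f x = L2fun_val g x}.
Proof.
have e : (\pi_L2 f == \pi_L2 g) = (f - g \in L2null) by rewrite Quotient.idealrBE.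
split=> [/eqP|fg].
  rewrite e unfold_in => /asboolP; apply: filterS => x /eqP.
  by rewrite L2funB subr_eq0 => /eqP.
apply/eqP; rewrite e unfold_in; apply/asboolP; apply: filterS fg => x fgx.
by rewrite L2funB fgx subrr.
Qed.

Lemma pi_L2D f g : \pi_L2 (f + g) = \pi_L2 f + \pi_L2 g.
Proof. exact: Quotient.pi_add. Qed.

Definition L2scale (a : R[i]) (f : L2) : L2 := \pi_L2 (a *: repr f).

Lemma pi_L2scale a f : L2scale a (\pi_L2 f) = \pi_L2 (a *: f).
Proof.
apply/L2P.
have : \pi_L2 (repr (\pi_L2 f)) = \pi_L2 f by rewrite reprK.
by move/L2P; apply: filterS => x fx; rewrite !L2funZ fx.
Qed.

Lemma L2scaleA a b f : L2scale a (L2scale b f) = L2scale (a * b) f.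
Proof. by elim/quotW: f => f; rewrite (pi_L2scale b) !pi_L2scale scalerA. Qed.

Lemma L2scale1 : left_id 1 L2scale.
Proof. by elim/quotW => f; rewrite pi_L2scale scale1r. Qed.

Lemma L2scaleDr : right_distributive L2scale +%R.
Proof.
move=> a; elim/quotW => f; elim/quotW => g.
by rewrite -pi_L2D !pi_L2scale -pi_L2D scalerDr.
Qed.

Lemma L2scaleDl f : {morph L2scale^~ f : a b / a + b}.
Proof.
move=> a b; elim/quotW: f => f.
by rewrite !pi_L2scale -pi_L2D scalerDl.
Qed.

HB.instance Definition _ := GRing.Zmodule_isLmodule.Build R[i] L2
  L2scaleA L2scale1 L2scaleDr L2scaleDl.

End L2_space.

Section L2_dot.
Context d (T : measurableType d) (R : realType).
Variable mu : {measure set T -> \bar R}.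
Local Notation L2 := (L2 mu).

Definition cRintegral (f : T -> R[i]) : R[i] :=
  (\int[mu]_x complex.Re (f x)) +i* (\int[mu]_x complex.Im (f x)).

Definition cintegrable (f : T -> R[i]) :=
  mu.-integrable setT (EFin \o (fun x => complex.Re (f x))) /\
  mu.-integrable setT (EFin \o (fun x => complex.Im (f x))).

Lemma cintegrable_sqint (f g : T -> R[i]) : f \in sqint mu -> g \in sqint mu ->
  cintegrable (fun x => f x * (g x)^*).
Proof.
move=> /andP[fr fi] /andP[gr gi].
have H (u v : T -> R) : u \in Lfun mu 2%:E -> v \in Lfun mu 2%:E ->
    mu.-integrable setT (EFin \o (fun x => u x * v x)).
  by move=> hu hv; apply/Lfun1_integrable; exact: Lfun2_mul_Lfun1.
split.
  rewrite (_ : _ \o _ = (EFin \o (fun x => complex.Re (f x) * complex.Re (g x))%R)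
     \+ (EFin \o (fun x => complex.Im (f x) * complex.Im (g x))%R))%E.
    by apply: integrableD => //; exact: H.
  apply/funext => x /=; rewrite complex_ReM -EFinD.
  by case: (g x) => a b /=; rewrite mulrN opprK.
rewrite (_ : _ \o _ = (EFin \o (fun x => complex.Im (f x) * complex.Re (g x))%R)
     \- (EFin \o (fun x => complex.Re (f x) * complex.Im (g x))%R))%E.
  by apply: integrableB => //; exact: H.
apply/funext => x /=; rewrite complex_ImM -EFinB.
by case: (g x) => a b /=; rewrite mulrN addrC.
Qed.

Lemma cRintegralD f g : cintegrable f -> cintegrable g ->
  cRintegral (fun x => f x + g x) = cRintegral f + cRintegral g.
Proof.
move=> [fr fi] [gr gi]; rewrite /cRintegral.
under eq_Rintegral do rewrite complex_ReD.
under [X in _ +i* X]eq_Rintegral do rewrite complex_ImD.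
by rewrite !RintegralD.
Qed.

Let intZ (b : R) (u : T -> R) : mu.-integrable setT (EFin \o u) ->
  mu.-integrable setT (EFin \o (fun x => b * u x)).
Proof.
move=> iu; rewrite (_ : _ \o _ = (fun x => b%:E * (EFin \o u) x)%E).
  exact: integrableZl.
by apply/funext => x /=; rewrite EFinM.
Qed.

Lemma cintegrableD f g : cintegrable f -> cintegrable g ->
  cintegrable (fun x => f x + g x).
Proof.
move=> [fr fi] [gr gi]; split.
  under [X in EFin \o X]eq_fun do rewrite complex_ReD.
  exact: (integrableD _ fr gr).
under [X in EFin \o X]eq_fun do rewrite complex_ImD.
exact: (integrableD _ fi gi).
Qed.

Lemma cintegrableZ (a : R[i]) f : cintegrable f ->
  cintegrable (fun x => a * f x).
Proof.
move=> [fr fi]; split.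
  under [X in EFin \o X]eq_fun do rewrite complex_ReM.
  exact: (integrableB _ (intZ (complex.Re a) fr) (intZ (complex.Im a) fi)).
under [X in EFin \o X]eq_fun do rewrite complex_ImM.
exact: (integrableD _ (intZ (complex.Re a) fi) (intZ (complex.Im a) fr)).
Qed.

Lemma cRintegralZ (a : R[i]) f : cintegrable f ->
  cRintegral (fun x => a * f x) = a * cRintegral f.
Proof.
move=> [fr fi]; rewrite /cRintegral.
under eq_Rintegral do rewrite complex_ReM.
under [X in _ +i* X]eq_Rintegral do rewrite complex_ImM.
rewrite RintegralB ?RintegralD//; [|exact: intZ..].
rewrite !RintegralZl//.
by case: a.
Qed.

Lemma cRintegral_conj f : cintegrable f ->
  cRintegral (fun x => (f x)^*) = (cRintegral f)^*.
Proof.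
move=> [fr fi]; rewrite /cRintegral /=; congr (_ +i* _).
  by apply: eq_Rintegral => x _; case: (f x).
rewrite -mulN1r -RintegralZl//.
by apply: eq_Rintegral => x _; rewrite mulN1r; case: (f x).
Qed.

Lemma cRintegral_ae f g : cintegrable f -> cintegrable g ->
  {ae mu, forall x, f x = g x} -> cRintegral f = cRintegral g.
Proof.
move=> [fr fi] [gr gi] fg; congr (_ +i* _); congr fine.
  apply: ae_eq_integral => //; [exact: (measurable_int mu fr)|
    exact: (measurable_int mu gr)|].
  by apply: filterS fg => x /= -> _.
apply: ae_eq_integral => //; [exact: (measurable_int mu fi)|
  exact: (measurable_int mu gi)|].
by apply: filterS fg => x /= -> _.
Qed.

(* A representative of [f]; it is determined almost everywhere only. *)
Definition L2_fun (f : L2) : T -> R[i] := L2fun_val (repr f).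

Definition L2dot (f g : L2) : R[i] :=
  cRintegral (fun x => L2_fun f x * (L2_fun g x)^*).

Lemma L2_fun_sqint f : L2_fun f \in sqint mu.
Proof. exact: (valP (repr f)). Qed.

Let int2 f g := cintegrable_sqint (L2_fun_sqint f) (L2_fun_sqint g).

Lemma L2_fun_pi (f : L2fun mu) :
  {ae mu, forall x, L2_fun (\pi_L2 f) x = L2fun_val f x}.
Proof. by apply/L2P; rewrite reprK. Qed.

Lemma L2_fun0 : {ae mu, forall x, L2_fun 0 x = 0}.
Proof.
have <- : \pi_L2 (0 : L2fun mu) = 0.
  by apply: (addrI (\pi_L2 0)); rewrite -pi_L2D !addr0.
exact: L2_fun_pi.
Qed.

Lemma L2_funD f g :
  {ae mu, forall x, L2_fun (f + g) x = L2_fun f x + L2_fun g x}.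
Proof.
by have := L2_fun_pi (repr f + repr g); rewrite pi_L2D !reprK.
Qed.

Lemma L2_funZ a f :
  {ae mu, forall x, L2_fun (a *: f) x = a * L2_fun f x}.
Proof. exact: (L2_fun_pi (a *: repr f)). Qed.

Lemma L2_fun_inj f g :
  {ae mu, forall x, L2_fun f x = L2_fun g x} -> f = g.
Proof. by move=> /L2P; rewrite !reprK. Qed.

Lemma L2dotC f g : L2dot f g = (L2dot g f)^*.
Proof.
rewrite /L2dot -cRintegral_conj//; congr cRintegral; apply/funext => x.
by rewrite rmorphM /= conjcK mulrC.
Qed.

Lemma L2dot_linear g : linear_for *%R (L2dot^~ g).
Proof.
move=> a f f'.
rewrite -cRintegralZ// -cRintegralD//; last exact: cintegrableZ.
apply: cRintegral_ae => //; first by apply: cintegrableD => //; exact: cintegrableZ.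
apply: filterS2 (L2_funD (a *: f) f') (L2_funZ a f) => x -> ->.
by rewrite mulrDl mulrA.
Qed.

Lemma L2dot_sesqui : bilinear_for
  (GRing.Scale.Law.clone _ _ *%R _) (GRing.Scale.Law.clone _ _ (Num.conj \; *%R) _)
  L2dot.
Proof.
split=> [g|f]; first exact: L2dot_linear.
move=> a g g' /=; rewrite L2dotC L2dot_linear (L2dotC f g) (L2dotC f g').
by rewrite rmorphD rmorphM.
Qed.

Lemma L2dot_gt0 (f : L2) : f != 0 -> 0 < L2dot f f.
Proof.
apply: contraNT => L0; apply/eqP.
have [fr fi] := int2 f f.
have eR x : complex.Re (L2_fun f x * (L2_fun f x)^*) =
    complex.Re (L2_fun f x) ^+ 2 + complex.Im (L2_fun f x) ^+ 2.
  by case: (L2_fun f x) => a b /=; rewrite mulrN opprK.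
have eI x : complex.Im (L2_fun f x * (L2_fun f x)^*) = 0.
  by case: (L2_fun f x) => a b /=; rewrite mulrN mulrC addNr.
have R0 x : 0 <= complex.Re (L2_fun f x * (L2_fun f x)^*).
  by rewrite eR addr_ge0// sqr_ge0.
have I0 : \int[mu]_x complex.Re (L2_fun f x * (L2_fun f x)^*) = 0.
  apply/eqP; rewrite eq_le Rintegral_ge0// andbT leNgt.
  apply: contra L0 => pos; rewrite /L2dot /cRintegral ltcE/= pos andbT.
  under eq_Rintegral do rewrite eI.
  by rewrite /Rintegral integral0.
apply: L2_fun_inj.
have : ae_eq mu setT (EFin \o (fun x => complex.Re (L2_fun f x * (L2_fun f x)^*)))
   (cst 0%E).
  apply/ae_eq_integral_abs => //; first exact: (measurable_int mu fr).
  under eq_integral do rewrite /= ger0_norm//.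
  rewrite -[LHS](fineK (integrable_fin_num measurableT fr)).
  exact: (congr1 EFin I0).
apply: filterS2 L2_fun0 => x -> /(_ I) [] /eqP.
rewrite eR paddr_eq0 ?sqr_ge0// !sqrf_eq0.
by case: (L2_fun f x) => a b /= /andP[/eqP -> /eqP ->].
Qed.

HB.instance Definition _ :=
  bilinear_isBilinear.Build R[i] L2 L2 R[i] _ _ L2dot L2dot_sesqui.

Lemma L2dot_herm f g : L2dot f g = (-1) ^+ false * Num.conj (L2dot g f).
Proof. by rewrite mul1r L2dotC. Qed.

HB.instance Definition _ :=
  isHermitianSesquilinear.Build R[i] L2 false Num.conj L2dot L2dot_herm.
HB.instance Definition _ := isDotProduct.Build R[i] L2 L2dot L2dot_gt0.

End L2_dot.

Arguments L2dot {d T R} mu f g.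

(* Every element of L2 is the class of a square-integrable function; the class
   of any other function is 0 by convention. *)
Definition L2class d (T : measurableType d) (R : realType)
    (mu : {measure set T -> \bar R}) (f : T -> R[i]) : L2 mu :=
  \pi_(L2 mu) (insubd 0 f).

Section L2_comp.
Context d1 d2 (T1 : measurableType d1) (T2 : measurableType d2) (R : realType).
Variables (mu1 : {measure set T1 -> \bar R}) (mu2 : {measure set T2 -> \bar R}).

(* Independent of the representative [L2_fun f] when [g] is measurable and maps
   [mu1] to a measure absolutely continuous with respect to [mu2]: see
   [L2comp_class] below. *)
Definition L2comp (g : T1 -> T2) (f : L2 mu2) : L2 mu1 :=
  L2class mu1 (L2_fun f \o g).

Lemma sqint_ae (f g : T1 -> R[i]) : f \in sqint mu1 ->
  measurable_fun setT (fun x => complex.Re (g x)) ->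
  measurable_fun setT (fun x => complex.Im (g x)) ->
  {ae mu1, forall x, f x = g x} -> g \in sqint mu1.
Proof.
have H (u v : T1 -> R) : u \in Lfun mu1 2%:E -> measurable_fun setT v ->
    {ae mu1, forall x, u x = v x} -> v \in Lfun mu1 2%:E.
  move=> /andP[/set_mem/= mu_ /set_mem/= fu] mv uv; apply/andP.
  split; apply/mem_set => //=; move: fu; rewrite /finite_norm.
  suff -> : ('N[mu1]_2[EFin \o v] = 'N[mu1]_2[EFin \o u])%E by [].
  rewrite unlock /=; congr (_ `^ _)%E; apply/esym/ae_eq_integral => //.
  - by apply/measurable_EFinP; apply: (measurableT_comp (measurable_powR _)) => //;
      exact: measurableT_comp.
  - by apply/measurable_EFinP; apply: (measurableT_comp (measurable_powR _)) => //;
      exact: measurableT_comp.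
  - by apply: filterS uv => x /= ->.
move=> /andP[fr fi] gr gi fg; apply/andP; split.
  by apply: H fr gr _; apply: filterS fg => x ->.
by apply: H fi gi _; apply: filterS fg => x ->.
Qed.

Lemma L2class_ae (f g : T1 -> R[i]) : f \in sqint mu1 -> g \in sqint mu1 ->
  {ae mu1, forall x, f x = g x} -> L2class mu1 f = L2class mu1 g.
Proof. by move=> fS gS fg; apply/L2P; rewrite !val_insubd fS gS. Qed.

Lemma L2comp_class (g : T1 -> T2) (f : T2 -> R[i]) :
  measurable_fun setT g ->
  (forall B, measurable B -> mu2 B = 0%E -> mu1 (g @^-1` B) = 0%E) ->
  f \in sqint mu2 -> f \o g \in sqint mu1 ->
  L2comp g (L2class mu2 f) = L2class mu1 (f \o g).
Proof.
move=> mg g0 fS fgS.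
have e : {ae mu1, forall x, f (g x) = L2_fun (L2class mu2 f) (g x)}.
  have := L2_fun_pi (insubd 0 f : L2fun mu2); rewrite val_insubd fS.
  move=> [B [mB B0 hB]]; exists (g @^-1` B); split; [|exact: g0|].
    by rewrite -[_ @^-1` _]setTI; exact: mg.
  by move=> x /= nx; apply: hB => /= ex; apply: nx; rewrite ex.
apply: L2class_ae => //; last by apply: filterS e => x /= <-.
have /andP[/andP[/set_mem/= rm _] /andP[/set_mem/= im _]] :=
  L2_fun_sqint (L2class mu2 f).
apply: sqint_ae fgS _ _ e; first exact: (measurableT_comp rm mg).
exact: (measurableT_comp im mg).
Qed.

End L2_comp.

Arguments L2comp {d1 d2 T1 T2 R} mu1 mu2 g f.

Section operators.
Variables (R : realType) (U V : lmodType R[i]).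
Variables (dotU : {dot U for Num.conj}) (dotV : {dot V for Num.conj}).

Definition bounded_linear (T : U -> V) :=
  linear T /\
  exists M : R[i], forall u, sqrtC (dotV (T u) (T u)) <= M * sqrtC (dotU u u).

Definition is_adjoint (T : U -> V) (S : V -> U) :=
  forall u v, dotV (T u) v = dotU u (S v).

End operators.

(* Values on non-measurable sets are irrelevant. *)
Section operator_valued_measures.
Context d (Z : measurableType d) (R : realType) (U : lmodType R[i]).
Variable dotU : {dot U for Num.conj}.

Record is_povm (A : set Z -> U -> U) : Prop := {
  povm_bounded : forall D, measurable D -> bounded_linear dotU dotU (A D) ;
  povm_ge0 : forall D, measurable D -> forall h, 0 <= dotU (A D h) h ;
  povm_set0 : A set0 = fun=> 0 ;
  povm_setT : A setT = id ;
  povm_sigma_additive : forall D : nat -> set Z,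
    (forall n, measurable (D n)) -> trivIset setT D -> forall g h,
    series (fun n => dotU (A (D n) g) h : R[i]^o) @ \oo -->
      (dotU (A (\bigcup_n D n) g) h : R[i]^o)
}.

Record is_pvm (F : set Z -> U -> U) : Prop := {
  pvm_povm : is_povm F ;
  pvm_selfadjoint : forall D, measurable D -> is_adjoint dotU dotU (F D) (F D) ;
  pvm_idempotent : forall D, measurable D -> F D \o F D = F D ;
  pvm_setI : forall D1 D2, measurable D1 -> measurable D2 ->
    F (D1 `&` D2) = F D1 \o F D2
}.

End operator_valued_measures.

Section ifs.
Context (R : realType).

Definition lipschitz_contraction (Z : metricType R) (L : Z -> Z) :=
  exists2 r : R, 0 < r < 1 & forall x y, mdist (L x) (L y) <= r * mdist x y.

Definition is_ifs (Z : metricType R) (N : nat) (sigma : 'I_N -> Z -> Z) :=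
  forall i, lipschitz_contraction (sigma i).

Definition is_attractor (Z : metricType R) (N : nat) (sigma : 'I_N -> Z -> Z)
    (X : set Z) :=
  [/\ X !=set0, compact X & X = \bigcup_i sigma i @` X].

Definition is_hutchinson (Z : pmetricType R) (N : nat) (sigma : 'I_N -> Z -> Z)
    (mu : probability (borel Z) R) :=
  (forall f : Z -> R,
     (exists k : R, forall x y, `|f x - f y| <= k * mdist x y) ->
     mu.-integrable setT (EFin \o f)) /\
  forall D : set (borel Z), measurable D ->
    mu D = (N%:R^-1%:E * \sum_(i < N) mu (sigma i @^-1` D))%E.

End ifs.

(* The proof [hX] is recorded in the type so that [attractor_space hX] is
   canonically pointed. *)
Definition attractor_space (R : realType) (Y : completeMetricType R) (N : nat)
    (sigma : 'I_N -> Y -> Y) (X : set Y) (hX : is_attractor sigma X) : Type :=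
  set_type X.

Section attractor_space.
Context (R : realType) (Y : completeMetricType R) (N : nat).
Context (sigma : 'I_N -> Y -> Y) (X : set Y) (hX : is_attractor sigma X).

Local Notation attractor_space := (attractor_space hX).

Let attractor_point : attractor_space :=
  let: And3 X0 _ _ := hX in exist _ (projT1 (cid X0)) (mem_set (projT2 (cid X0))).

HB.instance Definition _ := Topological.copy attractor_space (set_type X).
HB.instance Definition _ := isPointed.Build attractor_space attractor_point.

Let attractor_stable i (x : attractor_space) : sigma i (val x) \in X.
Proof.
have [_ _ XE] := hX.
have sX : \bigcup_i sigma i @` X `<=` X by rewrite -XE.
by apply/mem_set/sX; exists i => //; exists (val x) => //; exact: set_valP.
Qed.

Definition attractor_map (i : 'I_N) (x : attractor_space) : attractor_space :=
  exist _ (sigma i (val x)) (attractor_stable i x).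

Lemma measurable_attractor : measurable (X : set (borel Y)).
Proof.
case: hX => _ cX _; rewrite -[X]setCK; apply: measurableC.
apply: sub_sigma_algebra; apply: closed_openC.
exact: (compact_closed (@metric_hausdorff _ _) cX).
Qed.

Lemma measurable_image_val (B : set (borel attractor_space)) : measurable B ->
  measurable ((set_val : attractor_space -> borel Y) @` B).
Proof.
move: B; apply: smallest_sub.
  split.
  - by rewrite image_set0.
  - move=> B mB; rewrite setTD.
    rewrite (_ : _ @` _ = X `\` (set_val @` B)).
      apply: measurableD => //; exact: measurable_attractor.
    apply/seteqP; split=> [_ [x Bx <-]|y [Xy nBy]].
      split; first exact: set_valP.
      by move=> [z Bz /val_inj zx]; apply: Bx; rewrite -zx.
    exists (exist _ y (mem_set Xy)) => // By; apply: nBy.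
    by exists (exist _ y (mem_set Xy)).
  - by move=> F mF; rewrite image_bigcup; exact: bigcup_measurable.
move=> _ [U oU <-].
rewrite (_ : _ @` _ = X `&` U).
  apply: measurableI; first exact: measurable_attractor.
  exact: sub_sigma_algebra.
apply/seteqP; split=> [_ [x Ux <-]|y [Xy Uy]].
  by split => //; exact: set_valP.
by exists (exist _ y (mem_set Xy)).
Qed.

Variable mu : probability (borel Y) R.

(* The Hutchinson measure is supported by X; this is its restriction to X. *)
Definition attractor_measure (B : set (borel attractor_space)) : \bar R :=
  mu ((set_val : attractor_space -> Y) @` B).

Let attractor_measure0 : attractor_measure set0 = 0%E.
Proof. by rewrite /attractor_measure image_set0 measure0. Qed.

Let attractor_measure_ge0 B : (0 <= attractor_measure B)%E.
Proof. exact: measure_ge0. Qed.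

Let attractor_measure_sigma_additive : semi_sigma_additive attractor_measure.
Proof.
move=> F mF tF mUF; rewrite /attractor_measure image_bigcup.
apply: (@measure_semi_sigma_additive _ _ _ mu (fun n => set_val @` F n)).
- by move=> n; exact: measurable_image_val.
- apply/trivIsetP => i j _ _ ij; rewrite -subset0 => _ [[x Fx <-] [z Fz]].
  move=> /val_inj zx; move/trivIsetP : tF => /(_ i j I I ij).
  by rewrite -subset0 => /(_ x); apply; split => //; rewrite -zx.
- by apply: bigcup_measurable => n _; exact: measurable_image_val.
Qed.

HB.instance Definition _ := isMeasure.Build _ _ _ attractor_measure
  attractor_measure0 attractor_measure_ge0 attractor_measure_sigma_additive.

End attractor_space.

Arguments attractor_map {R Y N sigma X} hX i x.
Arguments attractor_measure {R Y N sigma X} hX mu B.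

(* The sequence (alpha_1, alpha_2, ...) is encoded as n |-> alpha_(n+1). The
   parameters [R] (scalars of the metric) and [hN] (nonemptiness) are recorded
   in the type for the sake of the instances below. *)
Definition symbol_space (R : realType) (N : nat) (hN : (2 <= N)%N) : Type :=
  nat -> 'I_N.

Section symbol_space.
Context (R : realType) (N : nat) (hN : (2 <= N)%N).
Local Notation Omega := (symbol_space R hN).
Implicit Types a b c : Omega.

HB.instance Definition _ := Choice.on Omega.
HB.instance Definition _ :=
  isPointed.Build Omega (fun=> Ordinal (ltnW hN)).

Definition symbol_dist a b : R :=
  if pselect (exists n, a n != b n) is left ab then 2^-1 ^+ (ex_minn ab).+1
  else 0.

Let symbol_distxx a : symbol_dist a a = 0.
Proof.
rewrite /symbol_dist; case: pselect => // h; exfalso.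
by case: h => n; rewrite eqxx.
Qed.

Let symbol_dist_eq0 a b : symbol_dist a b = 0 -> a = b.
Proof.
rewrite /symbol_dist; case: pselect => [h /eqP|h _].
  by rewrite expf_eq0 /= invr_eq0 pnatr_eq0.
apply/funext => n; apply/eqP/negPn/negP => abn; apply: h.
by exists n.
Qed.

Let symbol_distC a b : symbol_dist a b = symbol_dist b a.
Proof.
rewrite /symbol_dist; case: pselect => [h|h]; case: pselect => [h'|h'] //.
- case: ex_minnP => m hm mP; case: ex_minnP => n hn nP.
  suff -> : m = n by [].
  by apply/eqP; rewrite eqn_leq mP 1?eq_sym// nP 1?eq_sym.
- by exfalso; apply: h'; case: h => n abn; exists n; rewrite eq_sym.
- by exfalso; apply: h; case: h' => n abn; exists n; rewrite eq_sym.
Qed.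

Let symbol_dist_ge0 a b : 0 <= symbol_dist a b.
Proof.
by rewrite /symbol_dist; case: pselect => // h; rewrite exprn_ge0// invr_ge0.
Qed.

Let symbol_dist_triangle b a c :
  symbol_dist a c <= symbol_dist a b + symbol_dist b c.
Proof.
rewrite {1}/symbol_dist; case: pselect => [h|h]; last first.
  by rewrite addr_ge0// symbol_dist_ge0.
case: ex_minnP => n acn nP.
have le_dist (u v : Omega) : u n != v n -> 2^-1 ^+ n.+1 <= symbol_dist u v.
  move=> uv; rewrite /symbol_dist; case: pselect => [h'|[]]; last by exists n.
  case: ex_minnP => m _ /(_ n uv) mn.
  by rewrite ler_wiXn2l// ?invr_ge0// invf_le1// ler1n.
have [abn|abn] := eqVneq (a n) (b n).
  by rewrite (le_trans (le_dist b c _)) ?lerDr ?symbol_dist_ge0// -abn.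
by rewrite (le_trans (le_dist a b _)) ?lerDl ?symbol_dist_ge0.
Qed.

HB.instance Definition _ := isMetric.Build R Omega
  symbol_distxx symbol_dist_eq0 symbol_distC symbol_dist_triangle.

Definition prepend (i : 'I_N) (a : Omega) : Omega :=
  fun n => if n is m.+1 then a m else i.

Definition shift (a : Omega) : Omega := fun n => a n.+1.

End symbol_space.

(* Finite compositions sigma_(alpha_1) \o ... \o sigma_(alpha_(n+1)), n >= 0. *)
Section coding_map.
Context (R : realType) (Y : completeMetricType R) (N : nat) (hN : (2 <= N)%N).
Context (sigma : 'I_N -> Y -> Y) (X : set Y) (hX : is_attractor sigma X).

Definition is_coding_map (p : symbol_space R hN -> attractor_space hX) :=
  forall a : symbol_space R hN,
    \bigcap_n ((\big[comp/idfun]_(k < n.+1) sigma (a k)) @` X) = [set val (p a)].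

End coding_map.

Section ifs_operators.
Context (R : realType) (N : nat).

Definition ifs_equation (Z : ptopologicalType) (H : lmodType R[i])
    (tau : 'I_N -> Z -> Z) (S Sadj : 'I_N -> H -> H)
    (A : set (borel Z) -> H -> H) :=
  forall D : set (borel Z), measurable D ->
    A D = fun h => \sum_(i < N) S i (A (tau i @^-1` D) (Sadj i h)).

Definition attractor_op (Y : completeMetricType R) (sigma : 'I_N -> Y -> Y)
    (X : set Y) (hX : is_attractor sigma X) (mu : probability (borel Y) R)
    (i : 'I_N) (phi : L2 (attractor_measure hX mu)) :
    L2 (attractor_measure hX mu) :=
  (Num.sqrt N%:R)^-1%:C *:
    L2comp (attractor_measure hX mu) (attractor_measure hX mu)
      (attractor_map hX i) phi.

Definition symbol_op (hN : (2 <= N)%N)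
    (P : probability (borel (symbol_space R hN)) R)
    (i : 'I_N) (phi : L2 P) : L2 P :=
  L2class P (fun a =>
    let eta_i : symbol_space R hN -> symbol_space R hN := prepend i in
    (Num.sqrt N%:R)%:C * L2_fun phi (shift a) * (\1_(range eta_i) a)%:C).

Definition coding_op (hN : (2 <= N)%N)
    (P : probability (borel (symbol_space R hN)) R)
    (Y : completeMetricType R) (sigma : 'I_N -> Y -> Y)
    (X : set Y) (hX : is_attractor sigma X) (mu : probability (borel Y) R)
    (p : symbol_space R hN -> attractor_space hX)
    (f : L2 (attractor_measure hX mu)) : L2 P :=
  L2comp P (attractor_measure hX mu) p f.

End ifs_operators.

Arguments attractor_op {R N Y sigma X} hX mu i phi.
Arguments symbol_op {R N hN} P i phi.
Arguments coding_op {R N hN} P {Y sigma X hX} mu p f.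

(* Main.v *)
From HB Require Import structures.
Require Import Defs.
From mathcomp Require Import all_boot all_order all_algebra.
From mathcomp Require Import all_classical all_reals all_analysis.
From mathcomp Require Import measurable_realfun.
From mathcomp Require Import sesquilinear complex.

Set Implicit Arguments.
Unset Strict Implicit.
Unset Printing Implicit Defensive.

Import Order.TTheory GRing.Theory Num.Theory.
Import numFieldNormedType.Exports.

Local Open Scope classical_set_scope.
Local Open Scope ring_scope.
Local Open Scope complex_scope.

(** The theorem is a uniqueness statement. The compression
    B(D) = V^* E(pi^-1 D) V solves the same equation
    B(D) = sum_i S_i B(sigma_i^-1 D) S_i^* as A, because V intertwines the two
    systems: T_i^* V = V F_i. This is the identity
    pi \o eta_i = sigma_i \o pi integrated against P (symbol_op_coding). Since V
    is an isometry (coding_op_isometry), B also has total mass the identity, as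
    A does.

    The equation has only one solution of total mass the identity. For a vector
    h let m_h(D) = <A(D)h, h>, a finite measure (povm_measure). As S_i^* = F_i,
    the equation becomes m_h(D) = sum_i m_(F_i h)(sigma_i^-1 D), while
    m_h(X) = <h, h> is prescribed. Theorem reproduced_unique says that this
    determines the measures. Iterating n times pulls D back along compositions
    of n maps, whose images have diameter at most r^n diam(X). If such a
    pull-back of D is not empty, then the pull-back of the r^n diam(X)-thickening
    of D is the whole of X. Comparing total masses, m_h(D) is at most m'_h of
    that thickening, for any other solution m'. Exhausting an open set from
    inside gives m_h <= m'_h, hence equality, on open sets; so the measures agree
    on Borel sets. Polarization (quadratic_form_inj) then recovers A(D) = B(D).

    The same uniqueness result shows that the image of P under pi is the
    Hutchinson measure (coding_map_measure), which is what makes V isometric: a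
    scalar self-similar measure mu is the family k |-> N^-k mu indexed by the
    natural numbers, with F_i = S. Here one needs that mu is carried by X
    (hutchinson_attractor): as the maps contract towards X, the e/r-neighbourhood
    of X has no more mass than its e-neighbourhood, so every neighbourhood of X
    has full mass. *)

(** * Borel sets and contractions *)

(** The subspace topology of the attractor is that of the restricted distance, so
    the results on metric spaces apply to it and to the ambient space alike. *)
Section attractor_metric.
Context (R : realType) (Y : completeMetricType R) (N : nat).
Context (sigma : 'I_N -> Y -> Y) (X : set Y) (hX : is_attractor sigma X).

HB.instance Definition _ :=
  PseudoMetric.copy (attractor_space hX) (set_type X).

Let adist (x y : attractor_space hX) : R := mdist (val x) (val y).

Let adist_ge0 x y : 0 <= adist x y. Proof. exact: mdist_ge0. Qed.

Let adist_positivity x y : adist x y = 0 -> x = y.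
Proof. by move=> /mdist_positivity/val_inj. Qed.

Let adist_ball (x : attractor_space hX) d : ball x d = [set y | adist x y < d].
Proof.
by rewrite [LHS](_ : _ = val @^-1` ball (val x) d)// ballEmdist.
Qed.

HB.instance Definition _ := PseudoMetric_isMetric.Build R (attractor_space hX)
  adist_ge0 adist_positivity adist_ball.

Lemma attractor_mdistE (x y : attractor_space hX) :
  mdist x y = mdist (val x) (val y).
Proof. by []. Qed.

End attractor_metric.

Lemma open_measurable_borel (Z : ptopologicalType) (U : set Z) :
  open U -> measurable (U : set (borel Z)).
Proof. exact: sub_sigma_algebra. Qed.

Lemma continuous_measurable_borel (Z W : ptopologicalType) (f : Z -> W) :
  continuous f -> measurable_fun setT (f : borel Z -> borel W).
Proof.
move=> /continuousP cf.
apply: (@measurability _ _ (borel Z) (borel W) _ _ (@open W) erefl).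
move=> _ [U oU <-].
by rewrite setTI; apply: open_measurable_borel; exact: cf.
Qed.

Lemma metric_openP (R : realType) (Z : metricType R) (U : set Z) : open U <->
  forall x, U x -> exists2 e : R, 0 < e & forall y, mdist x y < e -> U y.
Proof.
rewrite openE /=; split=> [h x Ux|h x Ux].
  have /metricType_numDomainType.nbhs_mdistP[e /= e0 eU] := h x Ux.
  by exists e.
by have [e e0 eU] := h x Ux; apply/metricType_numDomainType.nbhs_mdistP; exists e.
Qed.

Lemma lipschitz_continuous (R : realType) (Z W : metricType R) (f : Z -> W)
    (k : R) : (forall x y, mdist (f x) (f y) <= k * mdist x y) ->
  continuous f.
Proof.
move=> fk; apply/continuousP => U /metric_openP oU; apply/metric_openP => x /oU.
have k1 : 0 < `|k| + 1 by rewrite ltr_wpDl.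
move=> [e e0 eU]; exists (e / (`|k| + 1)); first by rewrite divr_gt0.
move=> y; rewrite ltr_pdivlMr// mulrC => xy; apply: eU.
rewrite (le_lt_trans (fk _ _))// (le_lt_trans _ xy)// ler_wpM2r ?mdist_ge0//.
by rewrite (le_trans (ler_norm _))// lerDl.
Qed.

(** A single ratio for all the maps makes every composition of n of them contract
    by r^n. *)
Definition uniform_contraction (R : realType) (Z : metricType R) (N : nat)
  (tau : 'I_N -> Z -> Z) (r : R) :=
  0 < r < 1 /\ forall i x y, mdist (tau i x) (tau i y) <= r * mdist x y.

(** Finitely many contractions have a common ratio: the largest of their ratios
    and of 1/2, the latter to keep it positive when there is no map at all. *)
Lemma ifs_uniform_contraction (R : realType) (Z : metricType R) (N : nat)
    (tau : 'I_N -> Z -> Z) : is_ifs tau ->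
  exists r : R, uniform_contraction tau r.
Proof.
move=> htau.
have /(_ _)/cid2 /= H : forall i, exists2 r : R, 0 < r < 1 &
    forall x y, mdist (tau i x) (tau i y) <= r * mdist x y by exact: htau.
pose c i := s2val (H i).
exists (\big[Num.max/2^-1]_i c i); split.
  apply/andP; split.
    by rewrite (lt_le_trans _ (bigmax_ge_id _ _ _ _))// invr_gt0.
  apply/bigmax_ltP; split=> [|i _]; first by rewrite invf_lt1// ltr1n.
  by have /andP[] := s2valP (H i).
move=> i x y; rewrite (le_trans (s2valP' (H i) x y))// ler_wpM2r ?mdist_ge0//.
exact: (le_bigmax _ c).
Qed.

Lemma mean_const (R : realType) (N : nat) (x : \bar R) : (0 < N)%N ->
  (0 <= x)%E -> (N%:R^-1%:E * \sum_(i < N) x = x)%E.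
Proof.
move=> N0 x0; have -> : (\sum_(i < N) x = N%:R%:E * x)%E.
  have -> : N%:R%:E = (\sum_(i < N) 1%:E)%E :> \bar R.
    by rewrite sumEFin sumr_const card_ord.
  rewrite ge0_sume_distrl => [|i _]; last by rewrite lee_fin.
  by apply: eq_bigr => i _; rewrite mul1e.
by rewrite muleA -EFinM mulVf ?mul1e// pnatr_eq0 -lt0n.
Qed.

(** * Measures reproduced by a family of contractions *)

Section reproduced_measures.
Context (R : realType) (Z : pmetricType R) (N : nat) (tau : 'I_N -> Z -> Z).
Context (r M : R) (I : Type) (F : 'I_N -> I -> I).

(** The scalar form of the equation A(D) = sum_i S_i A(tau_i^-1 D) S_i^*: for
    m h D = <A(D)h, h> and F i = S_i^* the two say the same on the diagonal. *)
Definition reproduced (m : I -> {measure set (borel Z) -> \bar R}) :=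
  forall h (D : set (borel Z)), measurable D ->
    m h D = (\sum_(i < N) m (F i h) (tau i @^-1` D))%E.

Context (m m' : I -> {measure set (borel Z) -> \bar R}).
Hypothesis tau_contr : uniform_contraction tau r.
Hypothesis Z_bounded : forall x y : Z, mdist x y <= M.
Hypothesis m_reproduced : reproduced m.
Hypothesis m'_reproduced : reproduced m'.
Hypothesis mm'T : forall h, m h setT = m' h setT.
Hypothesis m_finite : forall h, (m h setT < +oo)%E.

Let measurable_tau i (D : set (borel Z)) :
  measurable D -> measurable (tau i @^-1` D : set (borel Z)).
Proof.
move=> mD; rewrite -[_ @^-1` _]setTI.
apply: (continuous_measurable_borel (lipschitz_continuous (tau_contr.2 i))) => //.
Qed.

(** The induction on [n] replaces the compositions of [n] maps by single ones: if
    [D'] contains the thickening of [D] by r^(n+1) M, then tau_i^-1 D' contains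
    the thickening of tau_i^-1 D by r^n M. At scale M a nonempty set thickens to
    the whole space, where the total masses coincide. *)
Lemma reproduced_le_thickening n h (D D' : set (borel Z)) :
  measurable D -> measurable D' ->
  (forall x y : Z, D x -> mdist x y <= r ^+ n * M -> D' y) ->
  (m h D <= m' h D')%E.
Proof.
elim: n h D D' => [|n IH] h D D' mD mD' DD'.
  have [->|/set0P[x Dx]] := eqVneq D set0; first by rewrite measure0.
  rewrite (_ : D' = setT); last first.
    apply/seteqP; split=> // y _; apply: (DD' x) => //.
    by rewrite expr0 mul1r.
  by rewrite -mm'T le_measure// inE.
rewrite m_reproduced// m'_reproduced//; apply: lee_sum => i _.
apply: IH; [exact: measurable_tau..|] => x y Dx xy.
apply: (DD' (tau i x)) => //.
have [/andP[r0 _] tauP] := tau_contr.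
by rewrite (le_trans (tauP _ _ _))// exprS -mulrA ler_pM2l.
Qed.

(** An open set is the increasing union of the sets [W n] of points at distance at
    least 1/(n+1) from its complement, and a small enough thickening of [W n]
    stays inside it. *)
Lemma reproduced_le_open h (U : set Z) : open U -> (m h U <= m' h U)%E.
Proof.
move=> oU; have mU := open_measurable_borel oU.
pose V n : set Z := [set x | exists2 z, ~ U z & mdist z x < n.+1%:R^-1].
have oV n : open (V n).
  apply/metric_openP => x [z nUz zx]; exists (n.+1%:R^-1 - mdist z x).
    by rewrite subr_gt0.
  move=> y xy; exists z => //; rewrite (le_lt_trans (metric_triangle _ x _))//.
  by rewrite -ltrBrDl.
pose W n : set (borel Z) := ~` V n.
have mW n : measurable (W n).
  by apply: measurableC; exact: open_measurable_borel.
have UE : \bigcup_n W n = U.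
  apply/seteqP; split=> [x [n _ /= Wnx]|x Ux].
    apply: contrapT => nUx; apply: Wnx; exists x => //.
    by rewrite mdistxx invr_gt0.
  have /metric_openP/(_ _ Ux)[e e0 eU] := oU.
  have [n _ ne] := near_infty_natSinv_lt (PosNum e0).
  exists n => // -[z nUz zx]; apply: nUz; apply: eU.
  by rewrite metric_sym (lt_trans zx)//; apply: ne => /=.
have : (m h \o W) n @[n --> \oo] --> m h U.
  rewrite -UE; apply: nondecreasing_cvg_mu => //; first by rewrite UE.
  move=> a b ab; apply/subsetPset => x /= nV [z nUz zx]; apply: nV; exists z => //.
  by rewrite (lt_le_trans zx)// lef_pV2 ?posrE// ler_nat.
move=> mW_cvg; rewrite -(cvg_lim _ mW_cvg)//; apply: lime_le.
  by apply/cvg_ex; eexists; exact: mW_cvg.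
apply: nearW => n /=.
have [/andP[r0 r1] _] := tau_contr.
(* The scale k at which the thickening of W n is finer than 1/(n+1). *)
have [k rk] : exists k, r ^+ k * M < n.+1%:R^-1.
  have : r ^+ k * M @[k --> \oo] --> (0 * M).
    by apply: cvgMl; apply: cvg_expr; rewrite gtr0_norm.
  rewrite mul0r => /cvgrPdist_lt/(_ n.+1%:R^-1); rewrite invr_gt0 ltr0Sn.
  move=> /(_ isT)[k _ /(_ k (leqnn k))]; rewrite sub0r normrN => rk.
  by exists k; rewrite (le_lt_trans (ler_norm _)).
apply: (reproduced_le_thickening (n := k)) => // x y /= nV xy.
apply: contrapT => nUy; apply: nV; exists y => //.
by rewrite metric_sym (le_lt_trans xy).
Qed.

End reproduced_measures.

Theorem reproduced_unique (R : realType) (Z : pmetricType R) (N : nat)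
    (tau : 'I_N -> Z -> Z) (r M : R) (I : Type) (F : 'I_N -> I -> I)
    (m m' : I -> {measure set (borel Z) -> \bar R}) :
  uniform_contraction tau r -> (forall x y : Z, mdist x y <= M) ->
  reproduced tau F m -> reproduced tau F m' ->
  (forall h, m h setT = m' h setT) -> (forall h, (m h setT < +oo)%E) ->
  forall h (D : set (borel Z)), measurable D -> m h D = m' h D.
Proof.
move=> tauP ZM mP m'P mm' mfin h D mD.
apply: (@measure_unique _ _ (borel Z) (@open Z) (fun=> setT)) => //.
- exact: openI.
- by move=> _; exact: openT.
- by apply/seteqP; split=> // x _; exists 0%N.
move=> U oU; apply/eqP; rewrite eq_le; apply/andP; split.
  exact: (reproduced_le_open tauP ZM mP m'P).
by apply: (reproduced_le_open tauP ZM m'P mP) => // {}h; rewrite -mm'.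
Qed.

(** * The Hutchinson measure lives on the attractor *)

Lemma compact_mdist_bounded (R : realType) (Y : metricType R) (X : set Y) :
  compact X -> exists M : R, forall x y, X x -> X y -> mdist x y <= M.
Proof.
have [->|/set0P[x0 Xx0] cX] := eqVneq X set0; first by exists 0 => x y [].
pose d0 : Y -> R^o := mdist x0.
have cd0 : continuous d0.
  apply: (@lipschitz_continuous R Y R^o d0 1) => x y.
  rewrite mul1r ler_norml; apply/andP; split.
    by rewrite lerBrDr addrC lerBlDr (metric_sym x y) metric_triangle.
  by rewrite lerBlDl metric_triangle.
have /compact_bounded[M [_ /(_ (M + 1))]] : compact (d0 @` X).
  by apply: continuous_compact cX; exact: continuous_subspaceT.
rewrite ltrDl ltr01 => /(_ isT) HM.
have d0M x : X x -> mdist x0 x <= M + 1.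
  by move=> Xx; rewrite (le_trans (ler_norm _))//; apply: HM; exists x.
exists (M + 1 + (M + 1)) => x y Xx Xy.
by rewrite (le_trans (metric_triangle _ x0 _))// lerD ?d0M// metric_sym d0M.
Qed.

Section hutchinson.
Context (R : realType) (Y : completeMetricType R) (N : nat) (hN : (2 <= N)%N).
Context (sigma : 'I_N -> Y -> Y) (hsigma : is_ifs sigma).
Context (X : set Y) (hX : is_attractor sigma X).
Context (mu : probability (borel Y) R) (hmu : is_hutchinson sigma mu).

Let N0 : (0 < N%:R :> R). Proof. by rewrite ltr0n (ltn_trans _ hN). Qed.

Let X0 : X !=set0. Proof. by case: hX. Qed.

Let sigma_X i x : X x -> X (sigma i x).
Proof. by case: hX => _ _ XE Xx; rewrite XE; exists i => //; exists x. Qed.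

Lemma measurable_ifs i : measurable_fun setT (sigma i : borel Y -> borel Y).
Proof.
apply: continuous_measurable_borel.
by have [r _ sr] := hsigma i; exact: lipschitz_continuous sr.
Qed.

Let measurable_preimage i (D : set (borel Y)) :
  measurable D -> measurable (sigma i @^-1` D : set (borel Y)).
Proof. by move=> mD; rewrite -[_ @^-1` _]setTI; exact: measurable_ifs. Qed.

Let nbd (e : R) : set Y := [set y | exists2 x, X x & mdist x y < e].

Let open_nbd e : open (nbd e).
Proof.
apply/metric_openP => y [x Xx xy]; exists (e - mdist x y); first by rewrite subr_gt0.
move=> z yz; exists x => //; rewrite (le_lt_trans (metric_triangle _ y _))//.
by rewrite -ltrBrDl.
Qed.

Let measurable_nbd e : measurable (nbd e : set (borel Y)).
Proof. exact: open_measurable_borel. Qed.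

(** A map of the system sends the e/r-neighbourhood of [X] into the
    e-neighbourhood, since it sends [X] into itself and contracts by r. *)
Let nbd_grow r e : uniform_contraction sigma r ->
  (mu (nbd (e / r)) <= mu (nbd e))%E.
Proof.
move=> [/andP[r0 r1] sr].
rewrite [leRHS](hmu.2 _ (measurable_nbd e)).
rewrite -[leLHS](mean_const (ltn_trans _ hN))//.
rewrite lee_pmul2l// ?lte_fin ?invr_gt0//.
apply: lee_sum => i _; apply: le_measure; rewrite ?inE//.
  exact: measurable_preimage.
move=> y [x Xx xy]; exists (sigma i x); first exact: sigma_X.
by rewrite (le_lt_trans (sr _ _ _))// mulrC -ltr_pdivlMr.
Qed.

(** The e/r^n-neighbourhoods exhaust the space, and by [nbd_grow] none of them has
    more mass than the first. *)
Let nbd_full e : 0 < e -> mu (nbd e) = 1%E.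
Proof.
move=> e0; have [r rP] := ifs_uniform_contraction hsigma.
have [/andP[r0 r1] _] := rP.
have grow n : (mu (nbd (e / r ^+ n)) <= mu (nbd e))%E.
  elim: n => [|n]; first by rewrite expr0 divr1.
  apply: le_trans; rewrite exprSr invfM mulrA; exact: nbd_grow.
have nT : \bigcup_n nbd (e / r ^+ n) = setT.
  apply/seteqP; split=> // y _; have [x Xx] := X0.
  have : r ^+ k * mdist x y @[k --> \oo] --> (0 * mdist x y).
    by apply: cvgMl; apply: cvg_expr; rewrite gtr0_norm.
  rewrite mul0r => /cvgrPdist_lt/(_ e e0)[k _ /(_ k (leqnn k))].
  rewrite sub0r normrN => rk.
  exists k => //; exists x => //; rewrite ltr_pdivlMr ?exprn_gt0// mulrC.
  by rewrite (le_lt_trans (ler_norm _)).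
apply/eqP; rewrite eq_le probability_le1//= -(probability_setT mu) -nT.
have cv : (mu \o (fun n => nbd (e / r ^+ n) : set (borel Y))) n @[n --> \oo] -->
    mu (\bigcup_n nbd (e / r ^+ n)).
  apply: nondecreasing_cvg_mu => [n||]; [exact: measurable_nbd|by rewrite nT|].
  move=> m n mn; apply/subsetPset => y [x Xx xy]; exists x => //.
  rewrite (lt_le_trans xy)// ler_wpM2l ?(ltW e0)//.
  by rewrite lef_pV2 ?posrE ?exprn_gt0// ler_wiXn2l// ltW.
rewrite -(cvg_lim _ cv)//; apply: lime_le.
  by apply/cvg_ex; eexists; exact: cv.
by apply: nearW => n; exact: grow.
Qed.

(** Each neighbourhood of [X] has full measure, and the closed set [X] is the
    intersection of its 1/(n+1)-neighbourhoods. *)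
Lemma hutchinson_attractor : mu X = 1%E.
Proof.
have [_ cX _] := hX.
have clX : closed X := compact_closed (@metric_hausdorff _ _) cX.
have XE : \bigcap_n nbd n.+1%:R^-1 = X.
  apply/seteqP; split=> [y ny|y Xy n _]; last first.
    by exists y => //; rewrite mdistxx invr_gt0.
  apply: contrapT => nXy.
  have /metric_openP/(_ _ nXy)[e e0 eX] := closed_openC clX.
  have [n _ ne] := near_infty_natSinv_lt (PosNum e0).
  have [x Xx xy] := ny n I; apply: (eX x) => //.
  by rewrite metric_sym (lt_trans xy)//; apply: ne => /=.
have cv : (mu \o (fun n => nbd n.+1%:R^-1 : set (borel Y))) n @[n --> \oo] -->
    mu (\bigcap_n nbd n.+1%:R^-1).
  apply: nonincreasing_cvg_mu => [|n||].
  - by rewrite (le_lt_trans (probability_le1 _ _)) ?ltry.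
  - exact: measurable_nbd.
  - by rewrite XE; exact: measurable_attractor hX.
  - move=> m n mn; apply/subsetPset => y [x Xx xy]; exists x => //.
    by rewrite (lt_le_trans xy)// lef_pV2 ?posrE// ler_nat.
rewrite -XE -(cvg_lim _ cv)//; apply: lim_near_cst => //.
by apply: nearW => n /=; rewrite nbd_full// invr_gt0.
Qed.

Lemma hutchinson_setIX (B : set (borel Y)) : measurable B ->
  mu (X `&` B) = mu B.
Proof.
move=> mB; have mX := measurable_attractor hX.
rewrite [RHS](measureDI _ mB mX) setIC [X in (X + _)%E](_ : _ = 0%E) ?add0e//.
apply/eqP; rewrite -measure_le0 -[leRHS](@subee _ 1%:E)//.
rewrite -[in leRHS]hutchinson_attractor [X in (_ <= X - _)%E](_ : _ = 1%E); last first.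
  by rewrite hutchinson_attractor.
rewrite -(probability_setC _ mX); apply: le_measure; rewrite ?inE.
- exact: measurableD.
- exact: measurableC.
- by move=> y [].
Qed.

Local Notation nu := (attractor_measure hX mu).
Local Notation tau := (attractor_map hX).

Lemma attractor_measureT : nu setT = 1%E.
Proof.
rewrite /attractor_measure -hutchinson_attractor; congr (mu _).
apply/seteqP; split=> [_ [x _ <-]|y Xy]; first exact: set_valP.
by exists (exist _ y (mem_set Xy)).
Qed.

Lemma attractor_measure_ifs (D : set (borel (attractor_space hX))) :
  measurable D ->
  nu D = (N%:R^-1%:E * \sum_(i < N) nu (tau i @^-1` D))%E.
Proof.
move=> mD; have mVD := measurable_image_val mD.
rewrite {1}/attractor_measure hmu.2//; congr (_ * _)%E; apply: eq_bigr => i _.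
rewrite -hutchinson_setIX; last exact: measurable_preimage.
congr (mu _); apply/seteqP; split=> [y [Xy [z Dz zy]]|_ [x Dx <-]].
  exists (exist _ y (mem_set Xy)) => //=.
  by rewrite (_ : attractor_map _ _ _ = z)//; apply: val_inj; rewrite /= -zy.
by split; [exact: set_valP|exists (tau i x)].
Qed.

Lemma uniform_contraction_attractor r :
  uniform_contraction sigma r -> uniform_contraction tau r.
Proof. by move=> [r01 sr]; split => // i x y; exact: sr. Qed.

Lemma attractor_bounded :
  exists M : R, forall x y : attractor_space hX, mdist x y <= M.
Proof.
have [_ /compact_mdist_bounded[M XM] _] := hX.
by exists M => x y; apply: XM; exact: set_valP.
Qed.

Lemma measurable_attractor_map i : measurable_fun setT
  (tau i : borel (attractor_space hX) -> borel (attractor_space hX)).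
Proof.
apply: continuous_measurable_borel.
have [r /uniform_contraction_attractor[_ tr]] := ifs_uniform_contraction hsigma.
exact: lipschitz_continuous (tr i).
Qed.

End hutchinson.

(** * The symbol space and the coding map *)

Section symbols.
Context (R : realType) (N : nat) (hN : (2 <= N)%N).
Local Notation Omega := (symbol_space R hN).
Implicit Types a b : Omega.

Lemma symbol_mdist_lt a b n :
  mdist a b < 2^-1 ^+ n <-> forall k, (k < n)%N -> a k = b k.
Proof.
rewrite (_ : mdist a b = symbol_dist a b)// /symbol_dist.
case: pselect => [ab|nab]; last first.
  rewrite exprn_gt0 ?invr_gt0//; split=> // _ k _.
  by apply/eqP/negPn/negP => abk; apply: nab; exists k.
case: ex_minnP => m abm mP.
rewrite ltr_iXn2l ?invr_gt0// ?invf_lt1 ?ltr1n//; split=> [nm k kn|abn].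
  apply/eqP/negPn/negP => /mP mk.
  by move: (leq_ltn_trans mk kn); rewrite ltnNge -ltnS nm.
rewrite ltnS leqNgt; apply/negP => mn.
by move: abm; rewrite (abn _ mn) eqxx.
Qed.

(** The topology is that of cylinders: continuity of shift, prepending and coding
    is checked on finitely many coordinates. *)
Lemma symbol_openP (U : set Omega) : open U <->
  forall a, U a -> exists n, forall b, (forall k, (k < n)%N -> a k = b k) -> U b.
Proof.
split=> [/metric_openP oU a /oU [e e0 eU]|nU]; last first.
  apply/metric_openP => a /nU [n anU]; exists (2^-1 ^+ n).
    by rewrite exprn_gt0// invr_gt0.
  by move=> b /symbol_mdist_lt; exact: anU.
have : (2^-1 : R) ^+ k @[k --> \oo] --> (0 : R).
  by apply: cvg_expr; rewrite gtr0_norm ?invr_gt0// invf_lt1// ltr1n.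
move=> /cvgrPdist_lt/(_ e e0)[n _ /(_ n (leqnn n))].
rewrite sub0r normrN => ne; exists n => b /symbol_mdist_lt abn; apply: eU.
by rewrite (lt_trans abn)// (le_lt_trans (ler_norm _)).
Qed.

Lemma measurable_prepend i : measurable_fun setT
  (@prepend R N hN i : borel Omega -> borel Omega).
Proof.
apply: continuous_measurable_borel; apply/continuousP => U /symbol_openP oU.
apply/symbol_openP => a /= /oU [n nU]; exists n => b ab; apply: nU => -[|k]//= kn.
by apply: ab; exact: ltnW.
Qed.

Lemma measurable_shift : measurable_fun setT
  (@Defs.shift R N hN : borel Omega -> borel Omega).
Proof.
apply: continuous_measurable_borel; apply/continuousP => U /symbol_openP oU.
apply/symbol_openP => a /= /oU [n nU]; exists n.+1 => b ab; apply: nU => k kn.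
exact: ab.
Qed.

Lemma range_prependP i a : range (@prepend R N hN i) a <-> a 0%N = i.
Proof.
split=> [[b _ <-]//|<-]; exists (Defs.shift a) => //.
by apply/funext => -[].
Qed.

Lemma measurable_range_prepend i :
  measurable (range (@prepend R N hN i) : set (borel Omega)).
Proof.
apply: open_measurable_borel; apply/symbol_openP => a /range_prependP ai.
by exists 1%N => b ab; apply/range_prependP; rewrite -ab.
Qed.

Lemma shift_prepend i a : Defs.shift (prepend i a : Omega) = a.
Proof. by apply/funext. Qed.

End symbols.

Section coding.
Context (R : realType) (Y : completeMetricType R) (N : nat) (hN : (2 <= N)%N).
Context (sigma : 'I_N -> Y -> Y) (hsigma : is_ifs sigma).
Context (X : set Y) (hX : is_attractor sigma X).
Context (p : symbol_space R hN -> attractor_space hX) (hp : is_coding_map p).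
Local Notation Omega := (symbol_space R hN).
Local Notation word a n := (\big[comp/idfun]_(k < n) sigma (a k)).

Let wordS (a : nat -> 'I_N) n : word a n.+1 = sigma (a 0%N) \o word (a \o S) n.
Proof. by rewrite big_ord_recl. Qed.

Lemma coding_map_word (a : Omega) n : (word a n.+1 @` X) (val (p a)).
Proof.
have : [set val (p a)] (val (p a)) by [].
by rewrite -hp => /(_ n); exact.
Qed.

Let word_contr r (a : nat -> 'I_N) n x y : uniform_contraction sigma r ->
  mdist (word a n x) (word a n y) <= r ^+ n * mdist x y.
Proof.
move=> [/andP[r0 _] sr]; elim: n a => [|n IH] a.
  by rewrite !big_ord0 expr0 mul1r.
rewrite !wordS exprS -mulrA /= (le_trans (sr (a 0%N) _ _))// ler_pM2l//.
exact: (IH (a \o S)).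
Qed.

(** Two sequences with the same first n+1 entries have their codes in the image of
    [X] under one composition of n+1 maps, whose diameter is at most r^(n+1) M. *)
Lemma measurable_coding_map : measurable_fun setT
  (p : borel Omega -> borel (attractor_space hX)).
Proof.
have [r rP] := ifs_uniform_contraction hsigma.
have [/andP[r0 r1] sr] := rP.
have [M XM] := attractor_bounded hX.
apply: continuous_measurable_borel; apply/continuousP => U /metric_openP oU.
apply/symbol_openP => a /= /oU [e e0 eU].
have : r ^+ k * M @[k --> \oo] --> (0 * M).
  by apply: cvgMl; apply: cvg_expr; rewrite gtr0_norm.
rewrite mul0r => /cvgrPdist_lt/(_ e e0)[n _ /(_ n.+1 (leqnSn n))].
rewrite sub0r normrN => ne; exists n.+1 => b ab; apply: eU.
have [x Xx xa] := coding_map_word a n; have [y Xy yb] := coding_map_word b n.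
have ba : word b n.+1 = word a n.+1.
  by apply: eq_bigr => k _; rewrite ab.
rewrite attractor_mdistE -xa -yb ba (le_lt_trans (word_contr _ _ _ _ rP))//.
rewrite (le_lt_trans _ ne)// (le_trans _ (ler_norm _))//.
rewrite ler_pM2l ?exprn_gt0//.
exact: (XM (exist _ x (mem_set Xx)) (exist _ y (mem_set Xy))).
Qed.

(** The coding map conjugates eta_i with sigma_i: applying sigma_i to the nested
    sets that determine the code of [a] gives those of [prepend i a]. *)
Lemma coding_map_prepend i (a : Omega) :
  p (prepend i a) = attractor_map hX i (p a).
Proof.
apply: val_inj => /=; apply/esym.
suff : [set val (p (prepend i a))] (sigma i (val (p a))) by [].
rewrite -hp => -[|n] _.
  exists (val (p a)); first exact: set_valP.
  by rewrite big_ord_recl big_ord0.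
have [x Xx <-] := coding_map_word a n; exists x => //.
by rewrite wordS.
Qed.

End coding.

(** The image of [m] under [f], with the measurability of [f] that makes it a
    measure. *)
Definition image_measure d1 d2 (T1 : measurableType d1) (T2 : measurableType d2)
  (R : realType) (m : {measure set T1 -> \bar R}) (f : T1 -> T2)
  (mf : measurable_fun setT f) : {measure set T2 -> \bar R}.
Proof. by refine (pushforward m f : {measure set T2 -> \bar R}). Defined.

Section coding_measure.
Context (R : realType) (Y : completeMetricType R) (N : nat) (hN : (2 <= N)%N).
Context (sigma : 'I_N -> Y -> Y) (hsigma : is_ifs sigma).
Context (X : set Y) (hX : is_attractor sigma X).
Context (mu : probability (borel Y) R) (hmu : is_hutchinson sigma mu).
Context (P : probability (borel (symbol_space R hN)) R).
Context (hP : is_hutchinson (@prepend R N hN) P).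
Context (p : symbol_space R hN -> attractor_space hX) (hp : is_coding_map p).
Local Notation nu := (attractor_measure hX mu).

(** Both sides are self-similar probability measures on [X], so they agree by
    [reproduced_unique], applied to the families k |-> N^-k P(p^-1 D) and
    k |-> N^-k nu(D): self-similarity expresses the k-th member through the
    (k+1)-th. *)
Lemma coding_map_measure (D : set (borel (attractor_space hX))) :
  measurable D -> P (p @^-1` D) = nu D.
Proof.
move=> mD; have [r rP] := ifs_uniform_contraction hsigma.
have [M XM] := attractor_bounded hX.
have c0 k : 0 <= (N%:R^-1 : R) ^+ k by rewrite exprn_ge0// invr_ge0.
pose m k : {measure set (borel (attractor_space hX)) -> \bar R} :=
  mscale (NngNum (c0 k)) (image_measure P (measurable_coding_map hsigma hp)).
pose m' k : {measure set (borel (attractor_space hX)) -> \bar R} :=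
  mscale (NngNum (c0 k)) nu.
have mE k B : m k B = ((N%:R^-1 ^+ k)%:E * P (p @^-1` B))%E by [].
have m'E k B : m' k B = ((N%:R^-1 ^+ k)%:E * nu B)%E by [].
suff : m 0%N D = m' 0%N D by rewrite mE m'E expr0 !mul1e.
apply: (reproduced_unique (F := fun=> S) (uniform_contraction_attractor hX rP) XM) mD.
- move=> k B mB; rewrite mE hP.2; last first.
    by rewrite -[_ @^-1` _]setTI; exact: (measurable_coding_map hsigma hp).
  rewrite muleA -EFinM -exprSr ge0_sume_distrr//.
  apply: eq_bigr => i _; rewrite mE; congr (_ * P _)%E.
  by apply/funext => a /=; rewrite coding_map_prepend.
- move=> k B mB; rewrite m'E (attractor_measure_ifs hN hsigma hmu)//.
  by rewrite muleA -EFinM -exprSr ge0_sume_distrr.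
- move=> k; rewrite mE m'E preimage_setT probability_setT.
  by rewrite (attractor_measureT hN hsigma hX hmu).
- by move=> k; rewrite mE preimage_setT probability_setT mule1 ltry.
Qed.

End coding_measure.

(** * Square-integrable functions under changes of variable *)

Section change_of_variable.
Context d1 d2 (T1 : measurableType d1) (T2 : measurableType d2) (R : realType).
Context (m1 : {measure set T1 -> \bar R}) (m2 : {measure set T2 -> \bar R}).
Context (phi : T1 -> T2) (mphi : measurable_fun setT phi).

(** The change of variable is localized to a set [D] because [prepend i] maps
    [P] to a multiple of [P] on the range of [prepend i] only. *)
Section supported.
Context (D : set T2) (mD : measurable D) (c : {nonneg R}).
Hypothesis m2E : forall B, measurable B -> B `<=` D ->
  m2 B = (c%:num%:E * m1 (phi @^-1` B))%E.

Lemma ge0_integral_change (g : T2 -> \bar R) : measurable_fun setT g ->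
  (forall y, (0 <= g y)%E) -> (forall y, ~ D y -> g y = 0%E) ->
  (\int[m2]_y g y = c%:num%:E * \int[m1]_x g (phi x))%E.
Proof.
move=> mg g0 gD.
have -> : (\int[m2]_y g y = \int[m2]_(y in D) g y)%E.
  rewrite [RHS]integral_mkcond; apply: eq_integral => y _.
  by rewrite patchE; case: ifPn => // /negP yD; rewrite gD// => /mem_set.
have -> : (\int[m1]_x g (phi x) = \int[m1]_(x in phi @^-1` D) (g \o phi) x)%E.
  rewrite [RHS]integral_mkcond; apply: eq_integral => x _.
  rewrite patchE; case: ifPn => // /negP xD /=; rewrite gD// => Dx.
  by apply: xD; rewrite inE.
rewrite (eq_measure_integral (mscale c (image_measure m1 mphi))); last first.
  by move=> B mB BD; rewrite m2E.
rewrite ge0_integral_mscale//; last exact: measurable_funTS.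
rewrite -(ge0_integral_pushforward mphi)//.
exact: measurable_funTS.
Qed.

Lemma Rintegral_change (f : T2 -> R) :
  (forall y, ~ D y -> f y = 0) ->
  m2.-integrable setT (EFin \o f) ->
  m1.-integrable setT (EFin \o (f \o phi)) ->
  \int[m2]_y f y = c%:num * \int[m1]_x f (phi x).
Proof.
move=> fD if2 if1.
have mf : measurable_fun setT (EFin \o f) by exact: (measurable_int m2).
rewrite /Rintegral (integralE m2) (integralE m1).
rewrite fineB ?(integrable_pos_fin_num _ if2) ?(integrable_neg_fin_num _ if2)//.
rewrite [in RHS]fineB ?(integrable_pos_fin_num _ if1)
  ?(integrable_neg_fin_num _ if1)// mulrBr.
rewrite !ge0_integral_change//.
- have fp x : ((EFin \o f)^\+ (phi x) = (EFin \o (f \o phi))^\+ x)%E.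
    by rewrite !funeposE.
  have fn x : ((EFin \o f)^\- (phi x) = (EFin \o (f \o phi))^\- x)%E.
    by rewrite !funenegE.
  under eq_integral do rewrite fp.
  under [X in _ - fine (_ * X)%E]eq_integral do rewrite fn.
  rewrite !fineM//.
    exact: (integrable_neg_fin_num measurableT if1).
  exact: (integrable_pos_fin_num measurableT if1).
- exact: measurable_funeneg.
- by move=> y /fD fy; rewrite funenegE fy oppe0 maxxx.
- exact: measurable_funepos.
- by move=> y /fD fy; rewrite funeposE fy maxxx.
Qed.

Lemma cRintegral_change (f : T2 -> R[i]) :
  (forall y, ~ D y -> f y = 0) ->
  cintegrable m2 f -> cintegrable m1 (f \o phi) ->
  cRintegral m2 f = (c%:num)%:C * cRintegral m1 (f \o phi).
Proof.
move=> fD [fr fi] [pr pi]; rewrite /cRintegral.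
rewrite (Rintegral_change _ fr pr) => [|y /fD ->//].
rewrite (Rintegral_change _ fi pi) => [|y /fD ->//].
by apply/eqP; rewrite eq_complex /= !mul0r subr0 addr0 !eqxx.
Qed.

End supported.

End change_of_variable.

Section L2_closure.
Context (R : realType).

Lemma Lfun2P d (T : measurableType d) (m : {measure set T -> \bar R})
    (u : T -> R) : u \in Lfun m 2%:E <->
  measurable_fun setT u /\ (\int[m]_x (u x ^+ 2)%:E < +oo)%E.
Proof.
split=> [uL|[mu uoo]].
  have /andP[/set_mem mu _] := uL; split=> //.
  have /integrableP[_] := Lfun2_integrable_sqr uL.
  apply: le_lt_trans; rewrite le_eqVlt; apply/orP; left; apply/eqP.
  by apply: eq_integral => x _ /=; rewrite ger0_norm// sqr_ge0.
apply/andP; split; apply/mem_set => //=; rewrite /finite_norm unlock poweR_lty//.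
rewrite (_ : integral _ _ _ = (\int[m]_x (u x ^+ 2)%:E)%E)//.
apply: eq_integral => x _ /=.
by rewrite powR_mulrn// real_normK// num_real.
Qed.

Lemma Lfun2_comp d1 d2 (T1 : measurableType d1) (T2 : measurableType d2)
    (m1 : {measure set T1 -> \bar R}) (m2 : {measure set T2 -> \bar R})
    (phi : T1 -> T2) (c : {nonneg R}) : measurable_fun setT phi ->
  (forall B, measurable B -> (m1 (phi @^-1` B) <= c%:num%:E * m2 B)%E) ->
  forall u : T2 -> R, u \in Lfun m2 2%:E -> u \o phi \in Lfun m1 2%:E.
Proof.
move=> mphi m12 u /Lfun2P[mu uoo]; apply/Lfun2P; split.
  exact: measurableT_comp.
have mu2 : measurable_fun setT (fun y => (u y ^+ 2)%:E).
  by apply/measurable_EFinP; exact: measurable_funX.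
have u0 y : (0 <= (u y ^+ 2)%:E)%E by rewrite lee_fin sqr_ge0.
have -> : (\int[m1]_x ((u \o phi) x ^+ 2)%:E =
    \int[image_measure m1 mphi]_y (u y ^+ 2)%:E)%E.
  by rewrite (ge0_integral_pushforward mphi).
apply: (@le_lt_trans _ _ (\int[mscale c m2]_y (u y ^+ 2)%:E)%E).
  by apply: ge0_le_measure_integral => // B mB; exact: m12.
rewrite ge0_integral_mscale//.
by apply: lte_mul_pinfty.
Qed.

(** Composition with [phi] is defined on square-integrable functions as soon as
    the image of [m1] is dominated by a multiple of [m2]. For sigma_i the constant
    is N: self-similarity bounds the mass of sigma_i^-1 B by N times that of B,
    whatever the overlaps. *)
Lemma sqint_comp d1 d2 (T1 : measurableType d1) (T2 : measurableType d2)
    (m1 : {measure set T1 -> \bar R}) (m2 : {measure set T2 -> \bar R})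
    (phi : T1 -> T2) (c : {nonneg R}) : measurable_fun setT phi ->
  (forall B, measurable B -> (m1 (phi @^-1` B) <= c%:num%:E * m2 B)%E) ->
  forall f : T2 -> R[i], f \in sqint m2 -> f \o phi \in sqint m1.
Proof.
move=> mphi m12 f /andP[fr fi]; apply/andP; split.
  exact: (Lfun2_comp mphi m12 fr).
exact: (Lfun2_comp mphi m12 fi).
Qed.

Lemma sqintM_indic d (T : measurableType d) (m : {measure set T -> \bar R})
    (D : set T) (f : T -> R[i]) : measurable D -> f \in sqint m ->
  (fun x => f x * (\1_D x)%:C) \in sqint m.
Proof.
move=> mD /andP[fr fi].
have H (u : T -> R) : u \in Lfun m 2%:E -> (fun x => u x * \1_D x) \in Lfun m 2%:E.
  move=> /Lfun2P[mu uoo].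
  have mu1 : measurable_fun setT (fun x => u x * \1_D x).
    by apply: measurable_funM => //; exact: measurable_indic.
  apply/Lfun2P; split=> //; apply: le_lt_trans uoo; apply: ge0_le_integral => //.
  - by move=> x _; rewrite lee_fin sqr_ge0.
  - by apply/measurable_EFinP; exact: measurable_funX.
  - by apply/measurable_EFinP; exact: measurable_funX.
  - move=> x _; rewrite lee_fin exprMn; apply: ler_piMr; first exact: sqr_ge0.
    by rewrite indicE; case: (_ \in _); rewrite ?expr1n ?expr0n.
apply/andP; split.
  rewrite (_ : (fun x => _) = (fun x => complex.Re (f x) * \1_D x)); first exact: H.
  by apply/funext => x; rewrite complex_ReM /= mulr0 subr0.
rewrite (_ : (fun x => _) = (fun x => complex.Im (f x) * \1_D x)); first exact: H.
by apply/funext => x; rewrite complex_ImM /= mulr0 add0r.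
Qed.

End L2_closure.

(** * Adjoints, quadratic forms and positive operator-valued measures *)

Section inner_product.
Context (R : realType).
Implicit Types U V : lmodType R[i].

Section dot_algebra.
Context U (dot : {dot U for Num.conj}).
Implicit Types x y z : U.

Lemma dotDl x y z : dot (x + y) z = dot x z + dot y z :> R[i].
Proof. exact: linearDl. Qed.

Lemma dotDr x y z : dot z (x + y) = dot z x + dot z y :> R[i].
Proof. exact: linearDr. Qed.

Lemma dotBr x y z : dot z (x - y) = dot z x - dot z y :> R[i].
Proof. exact: linearBr. Qed.

Lemma dotZl a x z : dot (a *: x) z = a * dot x z :> R[i].
Proof. exact: linearZl_LR. Qed.

Lemma dotZr a x z : dot z (a *: x) = Num.conj a * dot z x :> R[i].
Proof. exact: linearZr_LR. Qed.

Lemma dot0l z : dot 0 z = 0 :> R[i].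
Proof. exact: linear0l. Qed.

Lemma dotC x y : dot x y = Num.conj (dot y x : R[i]) :> R[i].
Proof. by rewrite hermC expr0 mul1r. Qed.

Lemma dot_suml n (x : 'I_n -> U) z :
  dot (\sum_(i < n) x i) z = \sum_(i < n) dot (x i) z :> R[i].
Proof. exact: linear_sumlz. Qed.

Lemma dot_inj x y : (forall u, dot u x = dot u y :> R[i]) -> x = y.
Proof.
move=> xy; apply/eqP; rewrite -subr_eq0 -(dnorm_eq0 dot).
by apply/eqP; rewrite -[LHS]/(dot (x - y) (x - y) : R[i]) dotBr xy subrr.
Qed.

End dot_algebra.

Lemma is_adjointC U V (dotU : {dot U for Num.conj}) (dotV : {dot V for Num.conj})
    (T : U -> V) (S : V -> U) :
  is_adjoint dotU dotV T S -> is_adjoint dotV dotU S T.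
Proof. by move=> TS v u; rewrite dotC -TS -dotC. Qed.

Lemma adjoint_unique U V (dotU : {dot U for Num.conj})
    (dotV : {dot V for Num.conj}) (T : U -> V) (S S' : V -> U) :
  is_adjoint dotU dotV T S -> is_adjoint dotU dotV T S' -> S =1 S'.
Proof. by move=> TS TS' v; apply: (dot_inj (dot := dotU)) => u; rewrite -TS -TS'. Qed.

(** The defining relation of an adjoint alone forces linearity, the form being
    nondegenerate. *)
Lemma adjoint_linear U V (dotU : {dot U for Num.conj})
    (dotV : {dot V for Num.conj}) (T : U -> V) (S : V -> U) :
  is_adjoint dotU dotV T S -> linear S.
Proof.
move=> TS a v v'; apply: (dot_inj (dot := dotU)) => u.
by rewrite -TS !(dotDr, dotZr) -!TS.
Qed.

(** Polarization: for c(x, y) = <(A - B)x, y>, the vanishing of c(g + h, g + h)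
    gives c(g, h) + c(h, g) = 0, and that of c(i g + h, i g + h) gives
    c(g, h) = c(h, g). *)
Lemma quadratic_form_inj U (dot : {dot U for Num.conj}) (A B : U -> U) :
  linear A -> linear B -> (forall h, dot (A h) h = dot (B h) h :> R[i]) -> A = B.
Proof.
move=> lA lB AB; apply/funext => g.
(* C is introduced by its equation so that it stays folded below. *)
have [C CE] : exists C : U -> U, forall x, C x = A x - B x.
  by exists (fun x => A x - B x).
have CD x y : C (x + y) = C x + C y.
  by rewrite !CE -[x in LHS]scale1r lA lB !scale1r opprD addrACA.
have C0 : C 0 = 0 by apply: (addrI (C 0)); rewrite -CD !addr0.
have CZ a x : C (a *: x) = a *: C x.
  by rewrite !CE -[a *: x]addr0 lA lB opprD addrACA -scalerBr -[_ - B 0]CE C0 addr0.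
have qC h : dot (C h) h = 0 :> R[i].
  by rewrite CE -scaleN1r dotDl dotZl mulN1r AB subrr.
have cross x y : dot (C x) y + dot (C y) x = 0 :> R[i].
  by have := qC (x + y); rewrite CD !(dotDl, dotDr) !qC add0r addr0.
suff Cg : C g = 0 by apply/eqP; rewrite -subr_eq0 -CE Cg.
apply: (dot_inj (dot := dot)) => h; rewrite dotC [RHS]dotC; congr (Num.conj _).
have /eqP := cross ('i *: g) h.
rewrite CZ dotZl dotZr conjCi mulNr -mulrBr mulf_eq0 (negPf (neq0Ci _)) /=.
rewrite subr_eq0 => /eqP gh.
have := cross g h; rewrite -gh -mulr2n => /eqP; rewrite mulrn_eq0 /= => /eqP ->.
by rewrite dot0l.
Qed.

Lemma ge0_real_part (z : R[i]) : 0 <= z -> z = (complex.Re z)%:C.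
Proof. by case: z => a b; rewrite lecE /= => /andP[/eqP -> _]. Qed.

Lemma cvg_Re (u : nat -> R[i]) (l : R[i]) :
  (u : nat -> R[i]^o) @ \oo --> (l : R[i]^o) ->
  (fun n => complex.Re (u n)) @ \oo --> complex.Re l.
Proof.
move=> /cvgrPdist_lt ul; apply/cvgrPdist_lt => e e0.
have e0' : 0 < e%:C :> R[i] by rewrite ltcR.
apply: filterS (ul _ e0') => n h.
have : `|complex.Re (l - u n)|%:C < e%:C :> R[i].
  exact: le_lt_trans (normc_ge_Re _) h.
by rewrite ltcR complex_ReD; case: (u n).
Qed.

End inner_product.

Section povm_measure.
Context d (Z : measurableType d) (R : realType) (U : lmodType R[i]).
Context (dot : {dot U for Num.conj}) (A : set Z -> U -> U) (hA : is_povm dot A).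

(** Off the measurable sets a positive operator-valued measure is unconstrained,
    while a measure is nonnegative on every set, hence the cut-off. *)
Definition povm_form (h : U) (D : set Z) : \bar R :=
  if `[< measurable D >] then (complex.Re (dot (A D h) h))%:E else 0%E.

Lemma povm_formE h D : measurable D ->
  povm_form h D = (complex.Re (dot (A D h) h))%:E.
Proof. by rewrite /povm_form => mD; rewrite asboolT. Qed.

Let povm_form0 h : povm_form h set0 = 0%E.
Proof.
rewrite povm_formE// (povm_set0 hA).
by rewrite dot0l.
Qed.

Let povm_form_ge0 h D : (0 <= povm_form h D)%E.
Proof.
rewrite /povm_form; case: asboolP => // mD; rewrite lee_fin.
by have := povm_ge0 hA mD h; rewrite lecE => /andP[].
Qed.

Let povm_form_sigma_additive h : semi_sigma_additive (povm_form h).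
Proof.
move=> F mF tF mUF; rewrite povm_formE//.
rewrite (_ : (fun n => _) =
  EFin \o (fun n => complex.Re (\sum_(0 <= i < n) dot (A (F i) h) h))).
  apply: cvg_EFin; first by apply: nearW.
  apply: cvg_Re; exact: (povm_sigma_additive hA mF tF (g := h) (h := h)).
apply/funext => n /=.
rewrite (raddf_sum (@complex.Re R : {additive R[i] -> R})) -sumEFin.
by apply: eq_bigr => i _; rewrite povm_formE.
Qed.

HB.instance Definition _ h := isMeasure.Build _ _ _ (povm_form h)
  (povm_form0 h) (povm_form_ge0 h) (@povm_form_sigma_additive h).

Definition povm_measure (h : U) : {measure set Z -> \bar R} := povm_form h.

Lemma povm_measureE h D : measurable D ->
  povm_measure h D = (complex.Re (dot (A D h) h))%:E.
Proof. exact: povm_formE. Qed.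

End povm_measure.

(** * The coding isometry intertwines the two systems *)

Section L2_representatives.
Context d1 d2 (T1 : measurableType d1) (T2 : measurableType d2) (R : realType).
Context (m1 : {measure set T1 -> \bar R}) (m2 : {measure set T2 -> \bar R}).

Lemma L2class_fun (f : T1 -> R[i]) : f \in sqint m1 ->
  {ae m1, forall x, L2_fun (L2class m1 f) x = f x}.
Proof. by move=> fS; have := L2_fun_pi (insubd 0 f : L2fun m1); rewrite val_insubd fS. Qed.

Lemma L2dot_ae (f g : L2 m1) (u v : T1 -> R[i]) :
  u \in sqint m1 -> v \in sqint m1 ->
  {ae m1, forall x, L2_fun f x = u x} -> {ae m1, forall x, L2_fun g x = v x} ->
  L2dot m1 f g = cRintegral m1 (fun x => u x * (v x)^*).
Proof.
move=> uS vS fu gv; apply: cRintegral_ae.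
- exact: cintegrable_sqint (L2_fun_sqint _) (L2_fun_sqint _).
- exact: cintegrable_sqint.
- by apply: filterS2 fu gv => x -> ->.
Qed.

Context (phi : T1 -> T2) (mphi : measurable_fun setT phi) (c : {nonneg R}).
Hypothesis m12 :
  forall B, measurable B -> (m1 (phi @^-1` B) <= c%:num%:E * m2 B)%E.

Lemma ae_comp (Q : T2 -> Prop) :
  {ae m2, forall y, Q y} -> {ae m1, forall x, Q (phi x)}.
Proof.
move=> [B [mB B0 QB]]; exists (phi @^-1` B); split.
- by rewrite -[_ @^-1` _]setTI; exact: mphi.
- apply/eqP; rewrite -measure_le0 (le_trans (m12 mB))//.
  by rewrite B0 mule0.
- by move=> x; exact: QB.
Qed.

Lemma L2comp_fun (f : L2 m2) :
  {ae m1, forall x, L2_fun (L2comp m1 m2 phi f) x = L2_fun f (phi x)}.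
Proof. by apply: L2class_fun; apply: (sqint_comp mphi m12); exact: L2_fun_sqint. Qed.

Lemma sqint_L2_fun_comp (f : L2 m2) : L2_fun f \o phi \in sqint m1.
Proof. by apply: (sqint_comp mphi m12); exact: L2_fun_sqint. Qed.

End L2_representatives.

Lemma sqintZ d (T : measurableType d) (R : realType)
    (m : {measure set T -> \bar R}) (a : R[i]) (f : T -> R[i]) :
  f \in sqint m -> (fun x => a * f x) \in sqint m.
Proof.
move=> fS; have [_ /(_ a f 0 fS)] := sqint_submod_closed m.
rewrite (_ : a *: f + 0 = (fun x => a * f x))//; last by rewrite addr0.
by apply; case: (sqint_submod_closed m).
Qed.

Section self_similar.
Context (R : realType) (Z : ptopologicalType) (N : nat) (N0 : (0 < N)%N).
Context (tau : 'I_N -> Z -> Z) (m : {measure set (borel Z) -> \bar R}).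
Hypothesis mE : forall D : set (borel Z), measurable D ->
  m D = (N%:R^-1%:E * \sum_(i < N) m (tau i @^-1` D))%E.

Lemma self_similar_dominated i (D : set (borel Z)) : measurable D ->
  (m (tau i @^-1` D) <= (N%:R%:nng : {nonneg R})%:num%:E * m D)%E.
Proof.
move=> mD; rewrite [in leRHS]mE// muleA -EFinM mulfV ?pnatr_eq0 -?lt0n// mul1e.
by rewrite (bigD1 i)//= leeDl// sume_ge0.
Qed.

End self_similar.

Section intertwining.
Context (R : realType) (Y : completeMetricType R) (N : nat) (hN : (2 <= N)%N).
Context (sigma : 'I_N -> Y -> Y) (hsigma : is_ifs sigma).
Context (X : set Y) (hX : is_attractor sigma X).
Context (mu : probability (borel Y) R) (hmu : is_hutchinson sigma mu).
Context (P : probability (borel (symbol_space R hN)) R).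
Context (hP : is_hutchinson (@prepend R N hN) P).
Context (p : symbol_space R hN -> attractor_space hX) (hp : is_coding_map p).
Local Notation nu := (attractor_measure hX mu).
Local Notation Omega := (symbol_space R hN).
Local Notation V := (coding_op P mu p).
Local Notation F := (attractor_op hX mu).
Local Notation T := (symbol_op P).

Let N0 : (0 < N)%N. Proof. exact: ltn_trans hN. Qed.

Let mp := measurable_coding_map hsigma hp.

Let P_coding (B : set (borel (attractor_space hX))) : measurable B ->
  (P (p @^-1` B) <= (1%:nng : {nonneg R})%:num%:E * nu B)%E.
Proof. by move=> mB; rewrite (coding_map_measure hsigma hmu hP hp mB) mul1e. Qed.

Let nu_attractor i (B : set (borel (attractor_space hX))) : measurable B ->
  (nu (attractor_map hX i @^-1` B) <= (N%:R%:nng : {nonneg R})%:num%:E * nu B)%E.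
Proof.
by apply: self_similar_dominated => // D; exact: attractor_measure_ifs.
Qed.

Let P_shift (B : set (borel Omega)) : measurable B ->
  (P (@Defs.shift R N hN @^-1` B) <= (1%:nng : {nonneg R})%:num%:E * P B)%E.
Proof.
move=> mB; rewrite hP.2; last first.
  by rewrite -[_ @^-1` _]setTI; exact: measurable_shift.
by rewrite mul1e -[leRHS](mean_const N0)//; exact: lexx.
Qed.

(** Prepending symbols other than [i] never meets the range of [prepend i], so one
    term of the self-similarity equation survives. *)
Let P_range i (B : set (borel Omega)) : measurable B ->
  B `<=` range (@prepend R N hN i) ->
  P B = ((N%:R^-1%:nng : {nonneg R})%:num%:E * P (prepend i @^-1` B))%E.
Proof.
move=> mB Bi; rewrite hP.2// (bigD1 i)//= big1 ?adde0// => j ji.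
rewrite (_ : _ @^-1` _ = set0) ?measure0//; apply/seteqP; split=> // a /= /Bi.
by move=> /range_prependP /= ij; move: ji; rewrite ij eqxx.
Qed.

Lemma coding_op_fun f : {ae P, forall a, L2_fun (V f) a = L2_fun f (p a)}.
Proof. exact: (L2comp_fun mp P_coding). Qed.

Lemma coding_op_isometry f g : L2dot P (V f) (V g) = L2dot nu f g.
Proof.
have [fS gS] := (L2_fun_sqint f, L2_fun_sqint g).
rewrite (L2dot_ae (sqint_L2_fun_comp mp P_coding f)
  (sqint_L2_fun_comp mp P_coding g) (coding_op_fun f) (coding_op_fun g)).
rewrite [RHS](@cRintegral_change _ _ _ _ _ P nu p mp setT measurableT 1%:nng)//.
- by rewrite mul1r.
- move=> B mB _; rewrite [RHS]mul1e; apply/esym.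
  exact: (coding_map_measure hsigma hmu hP hp mB).
- by move=> x /(_ I).
- exact: (cintegrable_sqint fS gS).
- by apply: (cintegrable_sqint (sqint_L2_fun_comp mp P_coding f)
    (sqint_L2_fun_comp mp P_coding g)).
Qed.

Lemma attractor_op_fun i f : {ae nu, forall x,
  L2_fun (F i f) x = (Num.sqrt N%:R)^-1%:C * L2_fun f (attractor_map hX i x)}.
Proof.
have h1 := L2_funZ (Num.sqrt N%:R)^-1%:C (L2comp nu nu (attractor_map hX i) f).
have h2 := L2comp_fun (measurable_attractor_map hsigma i) (nu_attractor i) f.
by apply: filterS2 h1 h2 => x; rewrite /attractor_op => -> ->.
Qed.

Lemma symbol_op_sqint i (u : L2 P) :
  (fun a : Omega => (Num.sqrt N%:R)%:C * L2_fun u (Defs.shift a) *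
    (\1_(range (@prepend R N hN i)) a)%:C) \in sqint P.
Proof.
apply: (@sqintM_indic _ _ _ P); first exact: measurable_range_prepend.
by apply: sqintZ; exact: (sqint_L2_fun_comp (@measurable_shift R N hN) P_shift).
Qed.

Lemma coding_attractor_op_fun i f : {ae P, forall a,
  L2_fun (V (F i f)) a =
  (Num.sqrt N%:R)^-1%:C * L2_fun f (p (prepend i a))}.
Proof.
apply: filterS2 (coding_op_fun (F i f)) (ae_comp mp P_coding (attractor_op_fun i f)).
by move=> a -> ->; rewrite coding_map_prepend.
Qed.

(** This is T_i^* V = V F_i. The integrand on the left lives on the range of
    [prepend i], where [P] is 1/N times its image under [prepend i]; the change of
    variable turns shift into the identity and [p] into [sigma_i \o p]. *)
Lemma symbol_op_coding i u f : L2dot P (T i u) (V f) = L2dot P u (V (F i f)).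
Proof.
have fiS : (fun a => L2_fun f (p (prepend i a))) \in sqint P.
  rewrite (_ : (fun a => _) = (L2_fun f \o attractor_map hX i) \o p); last first.
    by apply/funext => a /=; rewrite coding_map_prepend.
  apply: (sqint_comp mp P_coding).
  exact: (sqint_L2_fun_comp (measurable_attractor_map hsigma i) (nu_attractor i)).
have fS := sqint_L2_fun_comp mp P_coding f.
have TS := symbol_op_sqint i u.
rewrite (L2dot_ae TS fS (L2class_fun TS) (coding_op_fun f)).
rewrite (L2dot_ae (L2_fun_sqint u) (sqintZ (Num.sqrt N%:R)^-1%:C fiS) _
  (coding_attractor_op_fun i f)); last by apply: filterE.
pose h a := L2_fun u a * (L2_fun f (p (prepend i a)))^*.
have ih : cintegrable P h by exact: cintegrable_sqint (L2_fun_sqint u) fiS.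
set k := (X in cRintegral _ X = _).
have kE : k \o prepend i = (fun a => (Num.sqrt N%:R)%:C * h a).
  apply/funext => a; rewrite /k /h /= shift_prepend indicE mem_set ?mulr1 ?mulrA//.
rewrite (@cRintegral_change _ _ _ _ _ P P _ (@measurable_prepend R N hN i) _
  (@measurable_range_prepend R N hN i) (N%:R^-1)%:nng).
- rewrite kE (_ : (fun a => _ * (_ * _)^*) =
      (fun a => (Num.sqrt N%:R)^-1%:C * h a)); last first.
    apply/funext => a; rewrite rmorphM /=.
    rewrite [X in _ * (X * _)](_ : _ = (Num.sqrt N%:R)^-1%:C) 1?mulrCA//.
    exact: conjc_real.
  (* The constants: sqrt(N) / N = 1 / sqrt(N). *)
  rewrite !cRintegralZ// mulrA; congr (_ * _).
  rewrite -rmorphM /=; congr (_%:C).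
  rewrite -[in X in X^-1](sqr_sqrtr (ler0n R N)) expr2 invfM mulfVK//.
  by rewrite gt_eqF// sqrtr_gt0 ltr0n.
- by move=> B mB BD; exact: P_range.
- move=> a ai; rewrite /k indicE memNset//.
  by rewrite mulr0 mul0r.
- exact: cintegrable_sqint TS fS.
- by rewrite kE; exact: cintegrableZ.
Qed.

End intertwining.

(** * The compression of the projection-valued measure *)

Theorem theorem2p26 (R : realType) (Y : completeMetricType R)
    (hY : separable_space Y)
    (N : nat) (hN : (2 <= N)%N)
    (sigma : 'I_N -> Y -> Y) (hsigma : is_ifs sigma)
    (X : set Y) (hX : is_attractor sigma X)
    (mu : probability (borel Y) R) (hmu : is_hutchinson sigma mu)
    (S Sadj : 'I_N ->
      L2 (attractor_measure hX mu) -> L2 (attractor_measure hX mu))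
    (hS : forall i, is_adjoint (L2dot (attractor_measure hX mu))
      (L2dot (attractor_measure hX mu)) (attractor_op hX mu i) (S i))
    (hSadj : forall i, is_adjoint (L2dot (attractor_measure hX mu))
      (L2dot (attractor_measure hX mu)) (S i) (Sadj i))
    (A : set (borel (attractor_space hX)) ->
      L2 (attractor_measure hX mu) -> L2 (attractor_measure hX mu))
    (hA : is_povm (L2dot (attractor_measure hX mu)) A)
    (hAeq : ifs_equation (attractor_map hX) S Sadj A)
    (P : probability (borel (symbol_space R hN)) R)
    (hP : is_hutchinson (@prepend R N hN) P)
    (Tadj : 'I_N -> L2 P -> L2 P)
    (hTadj : forall i, is_adjoint (L2dot P) (L2dot P)
      (symbol_op P i) (Tadj i))
    (E : set (borel (symbol_space R hN)) -> L2 P -> L2 P)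
    (hE : is_pvm (L2dot P) E)
    (hEeq : ifs_equation (@prepend R N hN) (symbol_op P) Tadj E)
    (p : symbol_space R hN -> attractor_space hX) (hp : is_coding_map p)
    (Vadj : L2 P -> L2 (attractor_measure hX mu))
    (hVadj : is_adjoint (L2dot (attractor_measure hX mu)) (L2dot P)
      (coding_op P mu p) Vadj) :
  forall D : set (borel (attractor_space hX)), measurable D ->
    Vadj \o E (p @^-1` D) \o coding_op P mu p = A D.
Proof.
move=> D mD.
have hE' := pvm_povm hE.
have mp := measurable_coding_map hsigma hp.
have mpre (B : set (borel (attractor_space hX))) : measurable B ->
      measurable (p @^-1` B : set (borel (symbol_space R hN))).
  by move=> mB; rewrite -[_ @^-1` _]setTI; exact: mp.
have mtau i (B : set (borel (attractor_space hX))) : measurable B ->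
    measurable (attractor_map hX i @^-1` B : set (borel (attractor_space hX))).
  by move=> mB; rewrite -[_ @^-1` _]setTI; exact: measurable_attractor_map.
have SadjE i f : Sadj i f = attractor_op hX mu i f.
  exact: (adjoint_unique (hSadj i) (is_adjointC (hS i))).
have TadjE i f : Tadj i (coding_op P mu p f) = coding_op P mu p (Sadj i f).
  apply: (dot_inj (dot := L2dot P)) => u.
  by rewrite -hTadj SadjE; exact: symbol_op_coding.
pose m := povm_measure hA.
pose m' h := image_measure (povm_measure hE' (coding_op P mu p h)) mp.
have mE h (B : set (borel (attractor_space hX))) : measurable B ->
    m h B = (complex.Re (L2dot (attractor_measure hX mu) (A B h) h))%:E.
  exact: povm_measureE.
have m'E h (B : set (borel (attractor_space hX))) : measurable B ->
    m' h B = (complex.Re (L2dot P (E (p @^-1` B) (coding_op P mu p h))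
      (coding_op P mu p h)))%:E.
  by move=> mB; exact: (povm_measureE hE' (coding_op P mu p h) (mpre B mB)).
(* The quadratic forms of A and of the compression satisfy the same equation and
   have the same total mass. *)
have [r rP] := ifs_uniform_contraction hsigma.
have [M XM] := attractor_bounded hX.
have mm' : forall h (B : set (borel (attractor_space hX))), measurable B ->
    m h B = m' h B.
  apply: (reproduced_unique (F := Sadj) (uniform_contraction_attractor hX rP) XM).
  - move=> h B mB; rewrite mE// hAeq// dot_suml.
    rewrite (raddf_sum (@complex.Re R : {additive R[i] -> R})) -sumEFin.
    by apply: eq_bigr => i _; rewrite mE ?hSadj//; exact: mtau.
  - move=> h B mB; rewrite m'E// hEeq ?dot_suml//; last exact: mpre.
    rewrite (raddf_sum (@complex.Re R : {additive R[i] -> R})) -sumEFin.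
    apply: eq_bigr => i _; rewrite m'E; last exact: mtau.
    rewrite hTadj TadjE; congr (complex.Re (L2dot P (E _ _) _))%:E.
    by apply/funext => a /=; rewrite coding_map_prepend.
  - move=> h; rewrite mE// m'E// preimage_setT (povm_setT hA) (povm_setT hE').
    by congr (complex.Re _)%:E; apply/esym; exact: coding_op_isometry.
  - by move=> h; rewrite mE// ltry.
apply: (quadratic_form_inj (dot := L2dot (attractor_measure hX mu))).
- move=> a x y /=; rewrite (adjoint_linear (is_adjointC hVadj)).
  by rewrite (povm_bounded hE' (mpre D mD)).1 (adjoint_linear hVadj).
- exact: (povm_bounded hA mD).1.
move=> h; rewrite (is_adjointC hVadj).
have /ge0_real_part := povm_ge0 hA mD h.
have /ge0_real_part := povm_ge0 hE' (mpre D mD) (coding_op P mu p h).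
move=> -> ->; congr (_%:C).
by have := mm' h D mD; rewrite mE// m'E// => -[].
Qed.
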